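(* Let $K_L$, $s$ and $I$ be as in the context, let $F:\mathcal{H}\to\mathbb{C}[D]$ be smooth and $\Phi_{L,v}^{F,H}(\tau,\zeta):=\downarrow_H\big(\Theta_L(\tau,\zeta;v)\otimes F(\tau)\big)$. Assume that $\Phi_{L,v}^{F,H}(\tau,\zeta+\tau\sigma_{v_+}+\overline\tau\sigma_{v_-}+\nu)=\mathbf{e}\big(-\tau\frac{\sigma_{v_+}^2}{2}-\overline\tau\frac{\sigma_{v_-}^2}{2}-(\sigma,\zeta)\big)\chi_\nu t_\sigma\Phi_{L,v}^{F,H}(\tau,\zeta)$ for all $\tau\in\mathcal{H}$, $\zeta\in L_\mathbb{C}$ and all $\sigma,\nu\in L^*$ with $\sigma+L,\nu+L\in K_L$. Then there is a unique function $G:\mathcal{H}\to\mathbb{C}[\overline{D}]$, $\overline D=I^\perp/I$, with $F=\uparrow_{I}G$, and $\Phi_{L,v}^{F,H}=\mathcal{P}\,\Phi_{L,v}^{G,H'}$, where $\Phi_{L,v}^{G,H'}(\tau,\zeta):=\downarrow_{H'}\big(\Theta_L(\tau,\zeta;v)\otimes G(\tau)\big)$.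
   Context: Discriminant forms: finite abelian groups with a $\mathbb{Q}/\mathbb{Z}$-valued quadratic form $q$ with non-degenerate bilinear form $(\cdot,\cdot)$; $Y^\perp$ orthogonal; isotropic = $q$ vanishes. For isotropic $Y$ in $E$: $\uparrow_Y\mathfrak{e}_\gamma=\sum_{\delta\in Y^\perp,\delta+Y=\gamma}\mathfrak{e}_\delta$ ($\mathbb{C}[Y^\perp/Y]\to\mathbb{C}[E]$) and $\downarrow_Y\mathfrak{e}_\delta=\mathfrak{e}_{\delta+Y}$ if $\delta\in Y^\perp$, else $0$ ($\mathbb{C}[E]\to\mathbb{C}[Y^\perp/Y]$); tensor products $\mathbb{C}[A]\otimes\mathbb{C}[B]=\mathbb{C}[A\oplus B]$. Let $L$ be an even lattice over $\mathbb{Z}$ with bilinear form $(\cdot,\cdot)$, $\lambda^2=(\lambda,\lambda)$, $D_L=L^*/L$; fix $v$: $L_\mathbb{R}=v_+\oplus v_-$ orthogonal, $v_+$ positive and $v_-$ negative definite, $x_{v_\pm}$ $\mathbb{C}$-linear projections; $\Theta_L(\tau,\zeta;v)=\sum_{\gamma\in D_L}\big[\sum_{\lambda\in L+\gamma}\mathbf{e}(\tau\frac{\lambda_{v_+}^2}{2}+\overline\tau\frac{\lambda_{v_-}^2}{2}+(\lambda,\zeta))\big]\mathfrak{e}_\gamma$, $\mathbf{e}(z)=e^{2\pi iz}$. $D$ is a discriminant form, $H\subseteq D_L\oplus D$ isotropic and horizontal ($H\cap D_L=H\cap D=0$), elements $\gamma=(\gamma_L,\gamma_D)$, projections $H_L,H_D$,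 $\Delta_H=H^\perp/H$. $K_L\subseteq D_L$ is a subgroup containing $H_L^\perp$ with a homomorphism $s:K_L\to H^\perp$ such that $s(x)_L=x$, $s(x)=(x,0)$ for $x\in H_L^\perp$, and $x\mapsto s(x)+H$ is injective with $q_{\Delta_H}(s(x)+H)=q_{D_L}(x)$. Then $I:=\{s(x)_D:x\in K_L\}\subseteq D$ is an isotropic subgroup with $I\cap H_D=I\cap H_D^\perp=0$; $I^\perp\subseteq D$, $\overline D=I^\perp/I$. For $\sigma,\nu\in L^*$ with $\sigma+L,\nu+L\in K_L$, the operators on $\mathbb{C}[\Delta_H]$ are $t_\sigma\mathfrak{e}_\beta=\mathfrak{e}_{\beta-(s(\sigma+L)+H)}$ and $\chi_\nu\mathfrak{e}_\beta=\mathbf{e}((s(\nu+L)+H,\beta))\mathfrak{e}_\beta$. Let $H\cap I^\perp:=\{\gamma\in H:\gamma_D\in I^\perp\}$ and $H'$ its (isomorphic) image in $D_L\oplus\overline D$ under $\gamma\mapsto(\gamma_L,\gamma_D+I)$, a horizontal isotropic subgroup, with $\Delta_{H'}=H'^\perp/H'$. For $\beta\in\Delta_H$ with a representative $x\in H^\perp$ having $x_D\in I^\perp$, $p(\beta):=(x_L,x_D+I)+H'\in\Delta_{H'}$ is well defined, and $\mathcal{P}:\mathbb{C}[\Delta_{H'}]\to\mathbb{C}[\Delta_H]$ is $\mathcal{P}\mathfrak{e}_\alpha=\sum_{\beta:\,p(\beta)=\alpha}\mathfrak{e}_\beta$ (in this situation $p$ is a bijection between these sets, so $\mathcal{P}$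 is the map induced by the injection $\iota_{\overline\Delta}$ of the paper). *)

(* Defs.v *)
From HB Require Import structures.
From mathcomp Require Import all_boot all_order all_algebra.
From mathcomp Require Import generic_quotient ring_quotient finalg complex finmap.
From mathcomp Require Import all_classical all_reals all_analysis.
From mathcomp Require Import summability ring.

Set Implicit Arguments.
Unset Strict Implicit.
Unset Printing Implicit Defensive.

Import Order.TTheory GRing.Theory Num.Theory.
Import numFieldNormedType.Exports.

Local Open Scope ring_scope.
Local Open Scope complex_scope.
Local Open Scope quotient_scope.


Definition ratint : {pred rat} := fun x => x \is a Num.int.

Fact ratint_zmod_closed : zmod_closed ratint.
Proof. by split=> [|x y]; rewrite ?inE /ratint ?unfold_in //; apply: rpredB. Qed.

HB.instance Definition _ := GRing.isZmodClosed.Build rat ratint ratint_zmod_closed.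

Definition QZ : Type := Quotient.quot ratint.
HB.instance Definition _ := ZmodQuotient.on QZ.
Definition qz (x : rat) : QZ := \pi_QZ x.


(* A finite abelian group with a Q/Z-valued quadratic form; a discriminant
   form is one that satisfies [qf_nondegenerate] below. *)
HB.mixin Record isFinQuadModule E of FinRing.Zmodule E := {
  qf : E -> QZ;
  qf_quadratic : forall (n : int) (x : E), qf (x *~ n) = qf x *~ (n ^+ 2);
  qf_polar_additive : forall x y z : E,
    qf (x + y + z) - qf (x + y) - qf z =
    (qf (x + z) - qf x - qf z) + (qf (y + z) - qf y - qf z)
}.

#[short(type="finQuadType")]
HB.structure Definition FinQuad := {E of isFinQuadModule E & FinRing.Zmodule E}.

Definition bf (E : finQuadType) (x y : E) : QZ := qf (x + y) - qf x - qf y.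

Definition qf_nondegenerate (E : finQuadType) : Prop :=
  forall x : E, (forall y : E, bf x y = 0) -> x = 0.

Section FinQuadTheory.
Variable E : finQuadType.
Implicit Types x y z : E.

Lemma bfC x y : bf x y = bf y x.
Proof. by rewrite /bf [x + y]addrC addrAC. Qed.

Lemma bfDl x y z : bf (x + y) z = bf x z + bf y z.
Proof. exact: qf_polar_additive. Qed.

Lemma bfBl x y z : bf (x - y) z = bf x z - bf y z.
Proof. by apply: (addIr (bf y z)); rewrite -bfDl !subrK. Qed.

Lemma bf0l z : bf 0 z = 0.
Proof. by rewrite -(subrr (0 : E)) bfBl subrr. Qed.

Lemma qf0 : qf (0 : E) = 0.
Proof. by rewrite -(mulr0z (0 : E)) qf_quadratic expr0n mulr0z. Qed.

Lemma qfN x : qf (- x) = qf x.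
Proof. by rewrite -mulrN1z qf_quadratic sqrrN expr1n. Qed.

Lemma qfD x y : qf (x + y) = qf x + qf y + bf x y.
Proof. by rewrite /bf -[_ - _ - _]addrA -opprD [RHS]addrC subrK. Qed.
End FinQuadTheory.

Section ProdFinQuad.
Variables A B : finQuadType.

HB.instance Definition _ := GRing.Zmodule.on (A * B)%type.

Definition prod_qf (x : A * B) : QZ := qf x.1 + qf x.2.

Fact prod_qf_quadratic (n : int) (x : A * B) :
  prod_qf (x *~ n) = prod_qf x *~ (n ^+ 2).
Proof.
have E1 : (x *~ n).1 = x.1 *~ n by exact: (raddfMz (@fst A B)).
have E2 : (x *~ n).2 = x.2 *~ n by exact: (raddfMz (@snd A B)).
by rewrite /prod_qf E1 E2 !qf_quadratic mulrzDl.
Qed.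

Fact prod_qf_polar_additive (x y z : A * B) :
  prod_qf (x + y + z) - prod_qf (x + y) - prod_qf z =
  (prod_qf (x + z) - prod_qf x - prod_qf z) +
  (prod_qf (y + z) - prod_qf y - prod_qf z).
Proof.
have split_polar u v : prod_qf (u + v) - prod_qf u - prod_qf v =
    bf u.1 v.1 + bf u.2 v.2.
  have -> : prod_qf (u + v) = prod_qf u + prod_qf v + (bf u.1 v.1 + bf u.2 v.2).
    by rewrite /prod_qf /= !qfD addrACA; congr (_ + _); exact: addrACA.
  by rewrite -addrA -opprD addrC addKr.
by rewrite !split_polar /= !bfDl addrACA.
Qed.

HB.instance Definition _ := isFinQuadModule.Build (A * B)%type
  prod_qf_quadratic prod_qf_polar_additive.
End ProdFinQuad.

Section Orthogonal.
Variables (E : finQuadType) (A : {set E}).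

Definition perp : {pred E} := fun x => [forall y in A, bf x y == 0].

Lemma perpP (x : E) : reflect {in A, forall y, bf x y = 0} (x \in perp).
Proof.
by apply: (iffP forall_inP) => h y yA; move: (h y yA) => /eqP.
Qed.

Fact perp_zmod_closed : zmod_closed perp.
Proof.
split=> [|x y /perpP hx /perpP hy]; apply/perpP => z zA; first exact: bf0l.
by rewrite bfBl hx // hy // subrr.
Qed.

HB.instance Definition _ := GRing.isZmodClosed.Build E perp perp_zmod_closed.

Record perpT := PerpT { pval : E; pvalP : pval \in perp }.

HB.instance Definition _ := [isSub for pval].
HB.instance Definition _ := [Finite of perpT by <:].
HB.instance Definition _ := [SubChoice_isSubZmodule of perpT by <:].
End Orthogonal.

Record isoSubgroup (E : finQuadType) := IsoSubgroup {
  iso_set :> {set E};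
  iso_zmod : zmod_closed iso_set;
  iso_qf0 : {in iso_set, forall y, qf y = 0}
}.

Section SubQuotient.
Variables (E : finQuadType) (Y : isoSubgroup E).

Definition iso_in_perp : {pred perpT Y} := fun x => pval x \in (Y : {set E}).

Fact iso_in_perp_zmod_closed : zmod_closed iso_in_perp.
Proof.
have [Y0 YB] := iso_zmod Y.
by split=> [|x y xY yY]; rewrite unfold_in /iso_in_perp /= ?YB.
Qed.

HB.instance Definition _ :=
  GRing.isZmodClosed.Build (perpT Y) iso_in_perp iso_in_perp_zmod_closed.

(* Y^\perp / Y *)
Definition subquot : Type := Quotient.quot iso_in_perp.

HB.instance Definition _ := ZmodQuotient.on subquot.

Definition subclass (x : perpT Y) : subquot := \pi_subquot x.
Definition subrepr (g : subquot) : perpT Y := repr g.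

Fact subreprK : cancel subrepr subclass.
Proof. exact: reprK. Qed.

HB.instance Definition _ := CanIsCountable subreprK.
HB.instance Definition _ := fintype.isFinite.Build subquot
  (pcan_enumP (can_pcan subreprK)).

Definition subquot_qf (g : subquot) : QZ := qf (pval (subrepr g)).

Lemma subclass_eq (x y : perpT Y) :
  (subclass x == subclass y) = (pval x - pval y \in (Y : {set E})).
Proof. by rewrite /subclass -Quotient.idealrBE unfold_in. Qed.

Lemma subquot_qfE (x : perpT Y) : subquot_qf (subclass x) = qf (pval x).
Proof.
have /eqP := subreprK (subclass x); rewrite subclass_eq => hY.
rewrite /subquot_qf -[in LHS](subrK (pval x) (pval (subrepr _))) qfD.
have /perpP hx := pvalP x.
by rewrite (iso_qf0 hY) bfC hx // add0r addr0.
Qed.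

Lemma subclassD (x y : perpT Y) : subclass (x + y) = subclass x + subclass y.
Proof. exact: (raddfD \pi_subquot). Qed.

Lemma subclassMz (x : perpT Y) n : subclass (x *~ n) = subclass x *~ n.
Proof. exact: (raddfMz \pi_subquot). Qed.

Lemma subclass_surj (g : subquot) : exists x, g = subclass x.
Proof. by exists (subrepr g); rewrite subreprK. Qed.

Fact subquot_qf_quadratic (n : int) (g : subquot) :
  subquot_qf (g *~ n) = subquot_qf g *~ (n ^+ 2).
Proof.
have [x ->] := subclass_surj g.
rewrite -subclassMz !subquot_qfE -qf_quadratic; congr qf.
exact: (raddfMz (val : perpT Y -> E)).
Qed.

Fact subquot_qf_polar_additive (x y z : subquot) :
  subquot_qf (x + y + z) - subquot_qf (x + y) - subquot_qf z =
  (subquot_qf (x + z) - subquot_qf x - subquot_qf z) +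
  (subquot_qf (y + z) - subquot_qf y - subquot_qf z).
Proof.
have [x' ->] := subclass_surj x; have [y' ->] := subclass_surj y.
have [z' ->] := subclass_surj z.
by rewrite -!subclassD !subquot_qfE; exact: qf_polar_additive.
Qed.

HB.instance Definition _ := isFinQuadModule.Build subquot
  subquot_qf_quadratic subquot_qf_polar_additive.
End SubQuotient.

(* An even lattice with a chosen Z-basis: L = Z^rk with its Gram matrix. *)
Record evenLattice := EvenLattice {
  rk : nat;
  gram : 'M[int]_rk;
  gram_sym : gram^T = gram;
  gram_even : forall x : 'rV[int]_rk, (2 %| ((x *m gram *m x^T) 0 0)%R)%Z;
  gram_nondeg : \det gram != 0
}.

Definition lform (L : evenLattice) (K : comNzRingType) (x y : 'rV[K]_(rk L)) : K :=
  (x *m map_mx intr (gram L) *m y^T) 0 0.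

Section Dual.
Variable L : evenLattice.
Local Notation n := (rk L).

Definition in_dual : {pred 'rV[rat]_n} := fun x =>
  `[< forall m : 'rV[int]_n, lform x (map_mx intr m) \is a Num.int >].

Lemma lformBl (K : comNzRingType) (x y z : 'rV[K]_n) :
  lform (x - y) z = lform x z - lform y z.
Proof. by rewrite /lform !mulmxBl !mxE. Qed.

Lemma lformDl (K : comNzRingType) (x y z : 'rV[K]_n) :
  lform (x + y) z = lform x z + lform y z.
Proof. by rewrite /lform !mulmxDl !mxE. Qed.

Lemma lformC (K : comNzRingType) (x y : 'rV[K]_n) : lform x y = lform y x.
Proof.
have trE (M : 'M[K]_1) : M 0 0 = M^T 0 0 by rewrite mxE.
by rewrite /lform [LHS]trE !trmx_mul trmxK matrix.map_trmx gram_sym mulmxA.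
Qed.

Lemma lformMz (K : comNzRingType) (x y : 'rV[K]_n) k :
  lform (x *~ k) y = lform x y *~ k.
Proof. by rewrite -scaler_int /lform -!scalemxAl mxE mulrzl. Qed.

Fact in_dual_zmod_closed : zmod_closed in_dual.
Proof.
split=> [|x y /asboolP hx /asboolP hy]; apply/asboolP => m.
  by rewrite -(subrr 0) lformBl subrr rpred0.
by rewrite lformBl rpredB.
Qed.

HB.instance Definition _ :=
  GRing.isZmodClosed.Build 'rV[rat]_n in_dual in_dual_zmod_closed.

Record dualL := Dual { dval : 'rV[rat]_n; dvalP : dval \in in_dual }.

HB.instance Definition _ := [isSub for dval].
HB.instance Definition _ := [Choice of dualL by <:].
HB.instance Definition _ := [SubChoice_isSubZmodule of dualL by <:].

(* L inside L^*: the vectors with integral coordinates. *)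
Definition in_lattice : {pred dualL} := fun x => dval x \is a mxOver Num.int.

Fact in_lattice_zmod_closed : zmod_closed in_lattice.
Proof.
split=> [|x y /mxOverP hx /mxOverP hy]; apply/mxOverP => i j; rewrite !mxE //.
exact: rpredB.
Qed.

HB.instance Definition _ :=
  GRing.isZmodClosed.Build dualL in_lattice in_lattice_zmod_closed.

(* D_L = L^* / L *)
Definition discL : Type := Quotient.quot in_lattice.

HB.instance Definition _ := ZmodQuotient.on discL.

Definition dclass (x : dualL) : discL := \pi_discL x.

Lemma dclass_eq (x y : dualL) :
  (dclass x == dclass y) = (dval x - dval y \is a mxOver Num.int).
Proof. by rewrite /dclass -Quotient.idealrBE unfold_in. Qed.

Lemma dclass_surj (g : discL) : exists x, g = dclass x.
Proof. by exists (repr g); rewrite /dclass reprK. Qed.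

Lemma dclassD (x y : dualL) : dclass (x + y) = dclass x + dclass y.
Proof. exact: (raddfD \pi_discL). Qed.

Lemma dclassMz (x : dualL) k : dclass (x *~ k) = dclass x *~ k.
Proof. exact: (raddfMz \pi_discL). Qed.

Lemma mxOver_intP (x : 'rV[rat]_n) :
  reflect (exists m : 'rV[int]_n, x = map_mx intr m) (x \is a mxOver Num.int).
Proof.
apply: (iffP idP) => [/mxOverP h|[m ->]]; last first.
  by apply/mxOverP => i j; rewrite mxE.
exists (map_mx Num.floor x); apply/matrixP => i j; rewrite !mxE.
by rewrite floorK.
Qed.

Lemma gram_det_dual (x : dualL) :
  (\det (gram L))%:~R *: dval x \is a mxOver Num.int.
Proof.
have /asboolP hx := dvalP x.
have xG : dval x *m map_mx intr (gram L) \is a mxOver Num.int.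
  apply/mxOverP => i j; rewrite !ord1 {i}.
  have := hx (delta_mx 0 j); rewrite /lform map_delta_mx trmx_delta -colE.
  by rewrite mxE.
have -> : (\det (gram L))%:~R *: dval x =
    dval x *m map_mx intr (gram L) *m map_mx intr (\adj (gram L)).
  by rewrite -mulmxA -map_mxM mul_mx_adj map_scalar_mx mul_mx_scalar.
apply/mxOverP => i j; rewrite mxE; apply: rpred_sum => k _; apply: rpredM.
  exact: (mxOverP xG).
by rewrite mxE; exact: intr_int.
Qed.

Let d := `|\det (gram L)|%N.

Fact absz_det_gt0 : (0 < d)%N.
Proof. by rewrite absz_gt0 gram_nondeg. Qed.

Definition disc_code (g : discL) : {ffun 'I_n -> 'I_d} :=
  [ffun i => Ordinal (ltn_pmod
    `|(Num.floor ((\det (gram L))%:~R * dval (repr g) 0 i)%R %% d)%Z|%N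
    absz_det_gt0)].

Lemma disc_code_inj : injective disc_code.
Proof.
move=> g h /ffunP gh; rewrite -(reprK g) -(reprK h); apply/eqP.
rewrite -/(dclass _) -/(dclass _) dclass_eq; apply/mxOverP => i j.
rewrite ord1 {i}; move/(_ j): gh; rewrite !ffunE => /(congr1 val) /=.
set a := repr g; set b := repr h.
have fl (x : dualL) :
    (\det (gram L))%:~R * dval x 0 j =
    (Num.floor ((\det (gram L))%:~R * dval x 0 j))%:~R.
  by have /mxOverP/(_ 0 j) := gram_det_dual x; rewrite mxE => /floorK ->.
have md (e : nat) (m : int) : (0 < e)%N ->
    (`|(m %% e)%Z| %% e)%N = `|(m %% e)%Z|%N /\ 0 <= (m %% e)%Z.
  move=> e_gt0; have e0 : e%:Z != 0 by rewrite -lt0n.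
  split; last exact: modz_ge0.
  by rewrite modn_small // -ltz_nat gez0_abs ?modz_ge0 // ltz_pmod.
have [-> ha] := md d (Num.floor ((\det (gram L))%:~R * dval a 0 j)) absz_det_gt0.
have [-> hb] := md d (Num.floor ((\det (gram L))%:~R * dval b 0 j)) absz_det_gt0.
move=> /(congr1 Posz); rewrite (gez0_abs ha) (gez0_abs hb) => /eqP.
rewrite eqz_mod_dvd dvdzE absz_nat -dvdzE => /dvdzP[q]; rewrite !mxE.
move/(congr1 (intr : int -> rat)); rewrite rmorphB /= -!fl -mulrBr rmorphM /=.
have det0 : (\det (gram L))%:~R != 0 :> rat by rewrite intr_eq0 gram_nondeg.
by rewrite mulrC => /(mulIf det0) ->.
Qed.

Definition disc_decode (c : {ffun 'I_n -> 'I_d}) : option discL :=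
  if pselect (exists g, disc_code g == c) is left e then Some (xchoose e) else None.

Fact disc_codeK : pcancel disc_code disc_decode.
Proof.
move=> g; rewrite /disc_decode; case: pselect => [e|]; last by case; exists g.
by congr Some; apply: disc_code_inj; apply/eqP/(xchooseP e).
Qed.

HB.instance Definition _ := PCanIsCountable disc_codeK.
HB.instance Definition _ := fintype.isFinite.Build discL (pcan_enumP disc_codeK).

Lemma qz_eq (x y : rat) : (qz x == qz y) = (x - y \is a Num.int).
Proof. by rewrite /qz -Quotient.idealrBE. Qed.

Lemma qzB (x y : rat) : qz (x - y) = qz x - qz y.
Proof. exact: (raddfB \pi_QZ). Qed.

Lemma qzD (x y : rat) : qz (x + y) = qz x + qz y.
Proof. exact: (raddfD \pi_QZ). Qed.

Lemma qzMz (x : rat) k : qz (x *~ k) = qz x *~ k.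
Proof. exact: (raddfMz \pi_QZ). Qed.

Definition disc_qf (g : discL) : QZ :=
  qz (lform (dval (repr g)) (dval (repr g)) / 2%:R).

Lemma half_lformD (x y : 'rV[rat]_n) :
  lform (x + y) (x + y) / 2%:R =
  lform x x / 2%:R + lform y y / 2%:R + lform x y.
Proof.
rewrite lformDl (lformC x (x + y)) (lformC y (x + y)) !lformDl (lformC y x).
by field.
Qed.

Lemma disc_qfE (x : dualL) :
  disc_qf (dclass x) = qz (lform (dval x) (dval x) / 2%:R).
Proof.
have /eqP := reprK (dclass x); rewrite -/(dclass _) dclass_eq.
case/mxOver_intP => m hm; apply/eqP; rewrite /disc_qf qz_eq.
rewrite -[dval (repr _)](subrK (dval x)) hm half_lformD addrAC addrK.
apply: rpredD; last by rewrite lformC; have /asboolP := dvalP x.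
have /dvdzP[q hq] := gram_even m.
have -> : lform (map_mx intr m) (map_mx intr m) = (q * 2)%:~R :> rat.
  by rewrite -hq /lform matrix.map_trmx -!map_mxM mxE.
by rewrite rmorphM /= mulfK.
Qed.

Fact disc_qf_quadratic (k : int) (g : discL) :
  disc_qf (g *~ k) = disc_qf g *~ (k ^+ 2).
Proof.
have [x ->] := dclass_surj g; rewrite -dclassMz !disc_qfE -qzMz; congr qz.
have -> : dval (x *~ k) = dval x *~ k by exact: (raddfMz (val : dualL -> 'rV[rat]_n)).
by rewrite lformMz lformC lformMz -mulrzA -expr2 mulrzAl.
Qed.

Fact disc_qf_polar_additive (x y z : discL) :
  disc_qf (x + y + z) - disc_qf (x + y) - disc_qf z =
  (disc_qf (x + z) - disc_qf x - disc_qf z) +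
  (disc_qf (y + z) - disc_qf y - disc_qf z).
Proof.
have polar (u v : dualL) : disc_qf (dclass (u + v)) - disc_qf (dclass u) -
    disc_qf (dclass v) = qz (lform (dval u) (dval v)).
  rewrite !disc_qfE half_lformD -!qzB; congr qz.
  by rewrite -addrA -opprD addrC addKr.
have [x' ->] := dclass_surj x; have [y' ->] := dclass_surj y.
have [z' ->] := dclass_surj z.
by rewrite -!dclassD !polar -qzD -lformDl.
Qed.

HB.instance Definition _ := isFinQuadModule.Build discL
  disc_qf_quadratic disc_qf_polar_additive.

End Dual.

Section GroupAlgebra.
Variable R : realType.

Definition ee (z : R[i]) : R[i] :=
  (expR (- (2%:R * pi * complex.Im z)))%:C *
  (cos (2%:R * pi * complex.Re z) +i* sin (2%:R * pi * complex.Re z)).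

(* e(b) for b in Q/Z does not depend on the chosen representative. *)
Definition eeQZ (b : QZ) : R[i] := ee ((ratr (repr b) : R)%:C).

Definition grpalg (A : finType) := {ffun A -> R[i]}.

Definition ebase (A : finType) (a : A) : grpalg A := [ffun a' => (a' == a)%:R].

Definition gscale (A : finType) (c : R[i]) (f : grpalg A) : grpalg A :=
  [ffun a => c * f a].

Definition linext (A B : finType) (phi : A -> grpalg B) (f : grpalg A) : grpalg B :=
  \sum_(a : A) gscale (f a) (phi a).

(* C[A] (x) C[B] = C[A (+) B] *)
Definition gtensor (A B : finType) (f : grpalg A) (g : grpalg B) : grpalg (A * B)%type :=
  [ffun p => f p.1 * g p.2].

Definition uparrow (E : finQuadType) (Y : isoSubgroup E) :
    grpalg (subquot Y) -> grpalg E :=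
  linext (fun g : subquot Y => \sum_(x : perpT Y | subclass x == g) ebase (pval x)).

Definition downarrow (E : finQuadType) (Y : isoSubgroup E) :
    grpalg E -> grpalg (subquot Y) :=
  linext (fun x : E =>
    if insub x is Some x' then ebase (subclass (x' : perpT Y)) else 0).

Definition uhp := {z : R[i] | 0 < complex.Im z}.

(* Iterated partial derivatives in x (true) and y (false). *)
Fixpoint partials (w : seq bool) (f : R * R -> R) : R * R -> R :=
  if w is b :: w' then
    fun p => 'D_(if b then (1, 0) else (0, 1)) (partials w' f) p
  else f.

Definition smooth_on (U : set (R * R)) (f : R * R -> R) : Prop :=
  forall (w : seq bool) (p : R * R), U p ->
    {for p, continuous (partials w f)} /\
    (forall b : bool, derivable (partials w f) p (if b then (1, 0) else (0, 1))).

(* Extension by 0 of a function on the upper half-plane, in the real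
   coordinates of x + iy. *)
Definition uhp_ext (f : uhp -> R) (p : R * R) : R :=
  if insub (p.1 +i* p.2) is Some t then f t else 0.

Definition smooth (A : finType) (F : uhp -> grpalg A) : Prop :=
  forall a : A,
    smooth_on [set p | 0 < p.2]%classic
      (uhp_ext (fun t => complex.Re (F t a))) /\
    smooth_on [set p | 0 < p.2]%classic
      (uhp_ext (fun t => complex.Im (F t a))).
End GroupAlgebra.

Section Theta.
Variables (R : realType) (L : evenLattice).

Record vsplit := VSplit {
  vpos : {vspace 'rV[R]_(rk L)};
  vneg : {vspace 'rV[R]_(rk L)};
  vsplit_full : (vpos + vneg)%VS = fullv;
  vsplit_direct : directv (vpos + vneg);
  vsplit_orth : forall x y, x \in vpos -> y \in vneg -> lform x y = 0;
  vpos_gt0 : forall x, x \in vpos -> x != 0 -> 0 < lform x x;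
  vneg_lt0 : forall x, x \in vneg -> x != 0 -> lform x x < 0
}.

Definition toR (l : dualL L) : 'rV[R]_(rk L) := map_mx ratr (dval l).
Definition toC (x : 'rV[R]_(rk L)) : 'rV[R[i]]_(rk L) := map_mx (real_complex R) x.

Variable v : vsplit.

Definition proj_pos (x : 'rV[R]_(rk L)) := daddv_pi (vpos v) (vneg v) x.
Definition proj_neg (x : 'rV[R]_(rk L)) := daddv_pi (vneg v) (vpos v) x.

(* tau x_{v_+}^2 / 2 + conj(tau) x_{v_-}^2 / 2 *)
Definition qtau (tau : uhp R) (x : 'rV[R]_(rk L)) : R[i] :=
  val tau * (lform (proj_pos x) (proj_pos x) / 2%:R)%:C +
  conjc (val tau) * (lform (proj_neg x) (proj_neg x) / 2%:R)%:C.

Definition Theta (tau : uhp R) (zeta : 'rV[R[i]]_(rk L)) : grpalg R (discL L) :=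
  [ffun g => summability.sum (fun l : {l : dualL L | dclass l == g} =>
     (ee (qtau tau (toR (val l)) + lform (toC (toR (val l))) zeta) : R[i]^o))].

Definition Phi (D : finQuadType) (H : isoSubgroup (discL L * D)%type)
    (F : uhp R -> grpalg R D) (tau : uhp R) (zeta : 'rV[R[i]]_(rk L)) :
    grpalg R (subquot H) :=
  downarrow H (gtensor (Theta tau zeta) (F tau)).
End Theta.

Section Context.
Variables (L : evenLattice) (D : finQuadType).
Local Notation E := (discL L * D)%type.

Definition horizontal (H : isoSubgroup E) : Prop :=
  (forall x : discL L, (x, 0) \in (H : {set E}) -> x = 0) /\
  (forall y : D, (0, y) \in (H : {set E}) -> y = 0).

Definition projL (H : isoSubgroup E) : {set discL L} :=
  [set x.1 | x in (H : {set E})].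

(* The subgroup K_L together with the homomorphism s : K_L -> H^\perp; the
   values of [sec] outside [KL] are irrelevant. *)
Record KLsection (H : isoSubgroup E) := KLSection {
  KL : {set discL L};
  sec : discL L -> perpT H;
  KL_zmod : zmod_closed KL;
  KL_perp : {subset perp (projL H) <= KL};
  secD : {in KL &, {morph sec : x y / x + y}};
  sec_fst : {in KL, forall x, (pval (sec x)).1 = x};
  sec_perp : {in perp (projL H), forall x, pval (sec x) = (x, 0)};
  sec_inj : {in KL &, injective (fun x => subclass (sec x))};
  sec_qf : {in KL, forall x, qf (subclass (sec x)) = qf x}
}.

Variables (H : isoSubgroup E) (S : KLsection H).

Definition Iset : {set D} := [set (pval (sec S x)).2 | x in KL S].

Lemma secB : {in KL S &, {morph sec S : x y / x - y}}.
Proof.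
have [_ KB] := KL_zmod S.
move=> x y xK yK /=; apply: (addIr (sec S y)); rewrite subrK -secD ?subrK //.
exact: KB.
Qed.

Fact Iset_zmod : zmod_closed Iset.
Proof.
have [K0 KB] := KL_zmod S.
split=> [|_ _ /imsetP[x xK ->] /imsetP[y yK ->]].
  apply/imsetP; exists 0 => //.
  by rewrite -(subrr (0 : discL L)) secB // subrr.
by apply/imsetP; exists (x - y); [exact: KB | rewrite secB].
Qed.

Fact Iset_qf0 : {in Iset, forall y, qf y = 0}.
Proof.
move=> _ /imsetP[x xK ->]; have := sec_qf xK.
rewrite {1}/qf /= subquot_qfE {1}/qf /= /prod_qf sec_fst //.
by move/(canRL (addKr _)) => ->; rewrite addNr.
Qed.

Definition Isub : isoSubgroup D := IsoSubgroup Iset_zmod Iset_qf0.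

Local Notation Dbar := (subquot Isub).

Definition Hprime_set : {set discL L * Dbar} :=
  [set g | [exists x : E, exists z : perpT Isub,
    [&& x \in (H : {set E}), pval z == x.2 & g == (x.1, subclass z)]]].

Lemma Hprime_setP (g : discL L * Dbar) :
  reflect (exists x z, [/\ x \in (H : {set E}), pval z = x.2
                         & g = (x.1, subclass z)])
          (g \in Hprime_set).
Proof.
rewrite inE; apply: (iffP existsP) => [[x /existsP[z /and3P[h1 /eqP h2 /eqP h3]]]|].
  by exists x, z.
by case=> x [z [h1 h2 h3]]; exists x; apply/existsP; exists z; rewrite h1 h2 h3 !eqxx.
Qed.

Fact Hprime_zmod : zmod_closed Hprime_set.
Proof.
have [H0 HB] := iso_zmod H.
split=> [|_ _ /Hprime_setP[x [z [xH zx ->]]] /Hprime_setP[y [t [yH ty ->]]]];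
  apply/Hprime_setP.
  by exists 0, 0; split => //; congr (_, _); exact/esym/(raddf0 \pi_(subquot Isub)).
exists (x - y), (z - t); split; first exact: HB.
  by rewrite /= zx ty.
by congr (_, _); exact/esym/(raddfB \pi_(subquot Isub)).
Qed.

Fact Hprime_qf0 : {in Hprime_set, forall y, qf y = 0}.
Proof.
move=> _ /Hprime_setP[x [z [xH zx ->]]]; rewrite -(iso_qf0 xH).
rewrite {1}/qf /= /prod_qf /= {2}/qf /= subquot_qfE zx.
by [].
Qed.

Definition Hprime : isoSubgroup (discL L * Dbar)%type :=
  IsoSubgroup Hprime_zmod Hprime_qf0.

(* The graph of the partially defined map p, written p(beta) = alpha on paper. *)
Definition prel (beta : subquot H) (alpha : subquot Hprime) : bool :=
  [exists x : perpT H, exists z : perpT Isub, exists y : perpT Hprime,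
    [&& subclass x == beta, pval z == (pval x).2,
        pval y == ((pval x).1, subclass z) & subclass y == alpha]].

Variable R : realType.

Definition Pmap : grpalg R (subquot Hprime) -> grpalg R (subquot H) :=
  linext (fun alpha => \sum_(beta | prel beta alpha) ebase R beta).

Definition tshift (sigma : dualL L) : grpalg R (subquot H) -> grpalg R (subquot H) :=
  linext (fun beta => ebase R (beta - subclass (sec S (dclass sigma)))).

Definition chiop (nu : dualL L) : grpalg R (subquot H) -> grpalg R (subquot H) :=
  linext (fun beta =>
    gscale (eeQZ R (bf (subclass (sec S (dclass nu))) beta)) (ebase R beta)).
End Context.

(* Main.v *)
Require Import Defs.
From HB Require Import structures.
From mathcomp Require Import all_boot all_order all_algebra.
From mathcomp Require Import generic_quotient ring_quotient finalg complex finmap.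
From mathcomp Require Import all_classical all_reals all_analysis.
From mathcomp Require Import summability ring lra.

Set Implicit Arguments.
Unset Strict Implicit.
Unset Printing Implicit Defensive.

Import Order.TTheory GRing.Theory Num.Theory.
Import numFieldNormedType.Exports.

Local Open Scope ring_scope.
Local Open Scope complex_scope.

(* Write Phi_beta as a combination of the theta components Theta_g with coefficients
   F_d, the sum running over the pairs (g, d) in the class beta; since H is horizontal,
   each g occurs at most once. The components Theta_g(tau, .) are linearly independent:
   averaging e(-(l0, zeta)) Theta_g(tau, zeta) over the N-torsion points zeta keeps only
   the terms l in l0 + N L^*, and for N large and divisible by det(gram) what is left is
   dominated by the single term of l0. Comparing coefficients in the transformation law
   with sigma = 0 shows that F_d vanishes unless d is orthogonal to I, and with nu = 0
   that F_d is I-invariant (every d occurs in some class because D_L is nondegenerate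
   and H is horizontal). Hence F descends to I^perp / I, and the last identity is a
   bijection between the pairs (g, d) in beta with d in I^perp and the pairs (g, e) in
   p(beta). *)

(** * The exponential e(z), characters of Q/Z and finite character sums *)

Section Exponential.
Variable R : realType.
Implicit Types (z w : R[i]) (r : R).

Lemma eeD z w : ee (z + w) = ee z * ee w.
Proof.
case: z w => [a b] [c d]; rewrite /ee /= !mulrDr opprD expRD cosD sinD.
by apply/eqP; rewrite eq_complex /=; apply/andP; split; apply/eqP; ring.
Qed.

Lemma ee0 : ee 0 = 1 :> R[i].
Proof. by rewrite /ee /= !mulr0 oppr0 expR0 cos0 sin0 mul1r. Qed.

Lemma ee_neq0 z : ee z != 0.
Proof.
apply/eqP => z0; have := eeD z (- z); rewrite subrr ee0 z0 mul0r => /eqP.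
by rewrite oner_eq0.
Qed.

Lemma eeMn z n : ee (z *+ n) = ee z ^+ n.
Proof. by elim: n => [|n IH]; rewrite ?mulr0n ?ee0 // mulrS exprS eeD IH. Qed.

Lemma ee_sum (I : finType) (f : I -> R[i]) : ee (\sum_i f i) = \prod_i ee (f i).
Proof. by apply: (big_morph _ eeD ee0). Qed.

Lemma ee_nat n : ee n%:R = 1 :> R[i].
Proof.
rewrite eeMn; have -> : ee 1 = 1 :> R[i]; last by rewrite expr1n.
by rewrite /ee /= mulr0 oppr0 expR0 mulr1 mul1r mulr_natl cos2pi sin2pi.
Qed.

Lemma ee_int (m : int) : ee m%:~R = 1 :> R[i].
Proof.
case: m => n; first exact: ee_nat.
rewrite NegzE mulrNz; have := eeD (- n.+1%:~R) n.+1%:~R.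
by rewrite addNr ee0 ee_nat mulr1.
Qed.

(** Subtracting the floor leaves a fractional part f with cos(2 pi f) = 1. The double-angle formula
    gives sin(pi f) = 0, while sin is positive on (0, pi), so f = 0. *)
Lemma ee_eq1 r : ee r%:C = 1 -> r \is a Num.int.
Proof.
move=> h; set f := r - (Num.floor r)%:~R.
have f_itv : 0 <= f < 1.
  by rewrite subr_ge0 ltrBlDl [_ + 1]addrC; apply/andP; split;
    [exact: floor_le_tmp | rewrite addrC -intrD1; exact: floorD1_gt].
have {h} : ee f%:C = 1.
  rewrite /f rmorphB /= eeD h mul1r -rmorphN /= -mulrNz.
  by rewrite rmorph_int ee_int.
rewrite /ee /= mulr0 oppr0 expR0 mul1r => -[+ _].
have -> : 2%:R * pi * f = (pi * f) *+ 2 by ring.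
rewrite cos_mulr2n cos2sin2 => h.
have /eqP : sin (pi * f) ^+ 2 = 0 by lra.
rewrite sqrf_eq0 => /eqP s0.
have f0 : f = 0.
  apply/eqP; rewrite eq_le; case/andP: f_itv => -> f1; rewrite andbT.
  rewrite leNgt; apply/negP => f0.
  have := @sin_gt0_pi R (pi * f); rewrite s0 ltxx => /(_ _)/negP; apply => //.
  by rewrite mulr_gt0 ?pi_gt0 //= gtr_pMr ?pi_gt0.
by move/eqP: f0; rewrite subr_eq0 => /eqP ->; rewrite intr_int.
Qed.

Lemma normr_ee z : `|ee z| = (expR (- (2%:R * pi * complex.Im z)))%:C.
Proof.
rewrite /ee normrM normc_def /= expr0n addr0 sqrtr_sqr ger0_norm ?expR_ge0 //.
by rewrite normc_def /= cos2Dsin2 sqrtr1 mulr1.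
Qed.

Lemma eeQZ_qz (x : rat) : eeQZ R (qz x) = ee ((ratr x : R)%:C).
Proof.
rewrite /eeQZ; have /eqP := reprK (qz x); rewrite -/(qz _) qz_eq => h.
rewrite -[repr _ ](subrK x) rmorphD /= rmorphD /= eeD.
by case/intrP: h => m ->; rewrite ratr_int rmorph_int ee_int mul1r.
Qed.

Lemma qz_surj (b : QZ) : exists x, b = qz x.
Proof. by exists (repr b); rewrite /qz reprK. Qed.

Lemma qz0 : qz 0 = 0.
Proof. by rewrite -(subrr (0 : rat)) qzB subrr. Qed.

Lemma eeQZD (b c : QZ) : eeQZ R (b + c) = eeQZ R b * eeQZ R c.
Proof.
have [x ->] := qz_surj b; have [y ->] := qz_surj c.
by rewrite -qzD !eeQZ_qz rmorphD rmorphD /= eeD.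
Qed.

Lemma eeQZ0 : eeQZ R 0 = 1.
Proof.
by rewrite -qz0 eeQZ_qz raddf0 ee0.
Qed.

Lemma eeQZ_neq0 (b : QZ) : eeQZ R b != 0.
Proof. exact: ee_neq0. Qed.

Lemma eeQZ_eq1 (b : QZ) : eeQZ R b = 1 -> b = 0.
Proof.
have [x ->] := qz_surj b; rewrite eeQZ_qz => /ee_eq1 h.
apply/eqP; rewrite -qz0 qz_eq subr0; move: h.
case/intrP => m; rewrite -(ratr_int R) => /(fmorph_inj (@ratr R)) ->.
exact: intr_int.
Qed.

(** The summands are the powers of q = e(k/N), an N-th root of unity that equals 1 exactly when N
    divides k; otherwise multiplication by q - 1 telescopes the sum to q^N - 1 = 0. *)
Lemma sum_unity_root (N : nat) (k : int) : (0 < N)%N ->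
  \sum_(j < N) ee ((k%:~R * j%:R / N%:R : R)%:C) =
  if (N%:Z %| k)%Z then N%:R else 0.
Proof.
move=> N0; pose q := ee ((k%:~R / N%:R : R)%:C).
have N0R : N%:R != 0 :> R by rewrite pnatr_eq0 -lt0n.
have jE (j : 'I_N) : ee ((k%:~R * j%:R / N%:R : R)%:C) = q ^+ j.
  rewrite -eeMn -rmorphMn /=; congr (ee _%:C).
  by rewrite -[RHS]mulr_natr mulrAC.
rewrite (eq_bigr _ (fun j _ => jE j)).
have qN : q ^+ N = 1.
  rewrite -eeMn -rmorphMn /= -mulr_natr divfK //.
  by rewrite rmorph_int ee_int.
case: ifPn => [/dvdzP[m hm]|ndvd].
  have -> : q = 1.
    by rewrite /q hm intrM mulfK // rmorph_int ee_int.
  by rewrite (eq_bigr (fun=> 1)) ?sumr_const ?card_ord // => j _; rewrite expr1n.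
have q1 : q - 1 != 0.
  rewrite subr_eq0; apply: contra ndvd => /eqP /ee_eq1 /intrP[m hm].
  apply/dvdzP; exists m; apply/eqP; rewrite -(eqr_int R) rmorphM /=.
  by rewrite -hm divfK.
by apply: (mulfI q1); rewrite -subrX1 qN subrr mulr0.
Qed.

(* Translating the index by [y] multiplies the sum by [chi y]. *)
Lemma sum_character (A : finZmodType) (B : {set A}) (chi : A -> R[i]) :
  zmod_closed B -> {in B &, forall x y, chi (x + y) = chi x * chi y} ->
  (exists2 y, y \in B & chi y != 1) -> \sum_(x in B) chi x = 0.
Proof.
move=> [B0 BB] chiD [y yB y1].
have BD (x z : A) : x \in B -> z \in B -> x + z \in B.
  by move=> xB zB; rewrite -[z]opprK -[- z]sub0r !BB.
have hs : \sum_(x in B) chi x = (\sum_(x in B) chi x) * chi y.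
  rewrite [LHS](reindex_inj (addIr y)) mulr_suml; apply: eq_big => x.
    by apply/idP/idP => h; [rewrite -(addrK y x) BB | exact: BD].
  by move=> h; rewrite chiD // -(addrK y x) BB.
have y1' : chi y - 1 != 0 by rewrite subr_eq0.
by apply: (mulIf y1'); rewrite mul0r mulrBr mulr1 -hs subrr.
Qed.
End Exponential.

(** * Unconditional summation over finite subsets of an index set *)

Section UnorderedSums.

#[local] Existing Instance totally_filter.

(** Records convergence together with the value: [summability.sum] is a total limit operator whose
    value alone does not certify convergence. *)
Variant hasum (K : numFieldType) (I : choiceType) (f : I -> K) (s : K) : Prop :=
  Hasum of ((fun B : {fset I} => \sum_(i <- B) f i : K^o) @ totally --> (s : K^o))%classic.

Section General.
Variables (K : numFieldType) (I : choiceType).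
Implicit Types (f g : I -> K) (s t e : K).

Lemma hasumP f s : hasum f s <-> forall e, 0 < e ->
  exists A : {fset I}, forall B : {fset I}, (A `<=` B)%fset ->
    `|s - \sum_(i <- B) f i| < e.
Proof.
split=> [[h] e e0|h].
  have /cvgrPdist_lt/(_ e e0)[A _ hA] := h.
  by exists A => B AB; exact: hA.
constructor; apply/cvgrPdist_lt => e e0; have [A hA] := h e e0.
by exists A => // B AB; exact: hA.
Qed.

Lemma hasum_sum f s : hasum f s -> summability.sum (f : I -> K^o) = s.
Proof.
case=> h; have e : (fun B : {fset I} => \sum_(i <- B) f i : K^o) = partial_sum f.
  by apply/funext => B; rewrite /partial_sum big_seq_fsetE.
by rewrite e in h; exact: (cvg_lim _ h).
Qed.

Lemma hasum_uniq f s t : hasum f s -> hasum f t -> s = t.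
Proof. by move=> /hasum_sum <- /hasum_sum <-. Qed.

Lemma hasumD f g s t : hasum f s -> hasum g t ->
  hasum (fun i => f i + g i) (s + t).
Proof.
case=> hf [hg]; constructor.
under eq_fun do rewrite big_split /=.
exact: (cvgD hf hg).
Qed.

Lemma hasumZ c f s : hasum f s -> hasum (fun i => c * f i) (c * s).
Proof.
case=> hf; constructor.
under eq_fun do rewrite -mulr_sumr.
exact: (@cvgMl_tmp _ _ _ _ _ c _ hf).
Qed.

Lemma hasum0 : hasum (fun _ : I => 0 : K) 0.
Proof.
constructor; under eq_fun do rewrite big1 //.
exact: cvg_cst.
Qed.

Lemma hasum_lincomb (J : finType) (c : J -> K) (F : J -> I -> K) (S : J -> K) :
  (forall j, hasum (F j) (S j)) ->
  hasum (fun i => \sum_j c j * F j i) (\sum_j c j * S j).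
Proof.
move=> hF; elim: (index_enum J) => [|j r IH].
  rewrite big_nil; have := hasum0.
  by congr hasum; apply/funext => i; rewrite big_nil.
rewrite big_cons; have := hasumD (hasumZ (c j) (hF j)) IH.
by congr hasum; apply/funext => i; rewrite big_cons.
Qed.

Lemma big_fset_disjU (A B : {fset I}) f : [disjoint A & B]%fset ->
  \sum_(i <- (A `|` B)%fset) f i = \sum_(i <- A) f i + \sum_(i <- B) f i.
Proof.
move=> dis; rewrite (big_fsetID _ (mem A)) /=; congr (_ + _); apply: eq_fbigl => i;
  rewrite !inE /=; have := fdisjointP dis i; case: (i \in A) (i \in B) => -[] //=.
all: by move/(_ isT).
Qed.

Lemma ler_fset_sum (A B : {fset I}) f : (forall i, 0 <= f i) -> (A `<=` B)%fset ->
  \sum_(i <- A) f i <= \sum_(i <- B) f i.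
Proof.
move=> f0 AB; rewrite [leRHS](big_fsetID _ (mem A)) /=.
have -> : [fset i in B | i \in A]%fset = A.
  by apply/fsetP => i; rewrite !inE /= andb_idl // => /(fsubsetP AB).
by rewrite lerDl sumr_ge0.
Qed.

Lemma hasum_dist_le f s x e (A : {fset I}) : hasum f s ->
  (forall B : {fset I}, (A `<=` B)%fset -> `|\sum_(i <- B) f i - x| <= e) ->
  `|s - x| <= e.
Proof.
(* The order of [K] is only partial. The bound [e] is real because it dominates a norm, so the goal
   may be refuted through a strict inequality. *)
move=> /hasumP hf hB; rewrite real_leNgt ?normr_real //; last first.
  by have := hB A (fsubset_refl A); move/(le_trans (normr_ge0 _))/ger0_real.
apply/negP => lt_e; have d0 : 0 < `|s - x| - e by rewrite subr_gt0.
have [A' hA'] := hf _ d0.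
have := hA' (A `|` A')%fset (fsubsetUr _ _).
have := hB (A `|` A')%fset (fsubsetUl _ _).
set S := \sum_(i <- _) _ => h1 h2.
have := le_lt_trans (ler_distD S s x) (ltr_leD h2 h1).
by rewrite subrK ltxx.
Qed.
End General.

Lemma hasum_reindex (K : numFieldType) (I J : choiceType) (h : I -> J) (h' : J -> I)
    (f : J -> K) (s : K) : cancel h h' -> cancel h' h ->
  hasum f s -> hasum (fun i => f (h i)) s.
Proof.
move=> hK h'K /hasumP hf; apply/hasumP => e e0.
have [A hA] := hf e e0; exists [fset h' j | j in A]%fset => B /fsubsetP AB.
have -> : \sum_(i <- B) f (h i) = \sum_(j <- [fset h i | i in B]%fset) f j.
  by rewrite big_imfset //=; exact: in2W (can_inj hK).
apply: hA; apply/fsubsetP => j jA; rewrite -(h'K j).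
by apply: in_imfset; apply: AB; apply: in_imfset.
Qed.

(** The finite sums increase with the index set, so they converge to their supremum. *)
Lemma ge0_hasum (R : realType) (I : choiceType) (f : I -> R) (M : R) :
  (forall i, 0 <= f i) -> (forall B : {fset I}, \sum_(i <- B) f i <= M) ->
  exists s, hasum f s.
Proof.
move=> f0 fM; pose E := [set \sum_(i <- B) f i | B in [set: {fset I}]]%classic.
have supE : has_sup E.
  split; first by exists (\sum_(i <- fset0) f i); exists fset0.
  by exists M => _ [B _ <-].
exists (sup E); apply/hasumP => e e0.
have [_ [A _ <-] hA] := sup_adherent e0 supE.
exists A => B AB; have BE : \sum_(i <- B) f i <= sup E.
  by apply: ub_le_sup; [case: supE | exists B].
rewrite ger0_norm ?subr_ge0 // ltrBlDr -ltrBlDl.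
by apply: (lt_le_trans hA); exact: ler_fset_sum.
Qed.

Section Complex.
Variables (R : realType) (I : choiceType) (f : I -> R[i]) (M : R).
Hypothesis fM : forall B : {fset I}, \sum_(i <- B) `|f i| <= M%:C.

Let nf i := complex.Re `|f i|.

Let nfE i : `|f i| = (nf i)%:C.
Proof. by rewrite /nf RRe_real ?normr_real. Qed.

Let nf_ge0 i : 0 <= nf i.
Proof. by rewrite -ler0c -nfE. Qed.

Let nf_sum (B : {fset I}) : \sum_(i <- B) nf i <= M.
Proof.
by rewrite -lecR rmorph_sum /=; under eq_bigr do rewrite -nfE; exact: fM.
Qed.

(** Both [g + nf] and [nf] are nonnegative with bounded finite sums, and [g] is their difference. *)
Let real_hasum (g : I -> R) : (forall i, `|g i| <= nf i) -> exists s, hasum g s.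
Proof.
move=> gf.
have [||s1 h1] := @ge0_hasum R I (fun i => g i + nf i) (M + M).
- by move=> i; have := gf i; rewrite ler_norml => /andP[+ _]; lra.
- move=> B; rewrite big_split /= lerD //; apply: le_trans (nf_sum B).
  by apply: ler_sum => i _; apply: le_trans (gf i); exact: ler_norm.
have [s2 h2] := ge0_hasum nf_ge0 nf_sum.
exists (s1 + (-1) * s2); have := hasumD h1 (hasumZ (-1) h2).
by congr hasum; apply/funext => i; ring.
Qed.

Lemma normal_hasum : exists s, hasum f s.
Proof.
have Re_le i : `|complex.Re (f i)| <= nf i.
  by rewrite -lecR -nfE; exact: normc_ge_Re.
have Im_le i : `|complex.Im (f i)| <= nf i.
  (* Multiplication by i keeps the norm and turns the imaginary part, up to sign, into the real
     part. *)
  rewrite -lecR -nfE; have := normc_ge_Re (f i * 'i%C).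
  rewrite ReiNIm normrN normrM; congr (_ <= _).
  by rewrite [X in _ * X]normc_def /= expr0n expr1n add0r sqrtr1 mulr1.
have [a /hasumP ha] := real_hasum Re_le.
have [b /hasumP hb] := real_hasum Im_le.
exists (a +i* b); apply/hasumP => e; rewrite ltcE /= => /andP[/eqP eI e0].
have eE : e = (complex.Re e)%:C by case: (e) eI => x y /= ->.
have e2 : 0 < complex.Re e / 2 by rewrite divr_gt0.
have [A hA] := ha _ e2; have [A' hA'] := hb _ e2.
exists (A `|` A')%fset => B; rewrite fsubUset => /andP[/hA h1 /hA' h2].
have -> : \sum_(i <- B) f i =
    (\sum_(i <- B) complex.Re (f i)) +i* (\sum_(i <- B) complex.Im (f i)).
  elim/big_rec3: _ => // i x y z _ ->; case: (f i) => u w /=.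
  by [].
set x := \sum_(i <- B) _ in h1 *; set y := \sum_(i <- B) _ in h2 *.
have -> : (a +i* b) - (x +i* y) = (a - x)%:C + 'i%C * (b - y)%:C.
  by rewrite [LHS]complexE /=.
apply: (le_lt_trans (ler_normD _ _)).
rewrite normrM [X in X * _]normc_def /= expr0n expr1n add0r sqrtr1 mul1r.
rewrite !normc_def /= !expr0n !addr0 !sqrtr_sqr eE -rmorphD ltcR.
by rewrite [ltRHS](splitr (complex.Re e)) ltrD.
Qed.

(** Once every finite set above [A] has its sum of norms within e/2 of the total, joining a disjoint
    [B] to [A] changes that sum by less than e. *)
Lemma normal_tail (e : R) : 0 < e -> exists A : {fset I}, forall B : {fset I},
  [disjoint A & B]%fset -> \sum_(i <- B) `|f i| < e%:C.
Proof.
move=> e0; have [s /hasumP hs] := ge0_hasum nf_ge0 nf_sum.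
have e2 : 0 < e / 2 by rewrite divr_gt0.
have [A hA] := hs _ e2; exists A => B dis.
under eq_bigr do rewrite nfE.
rewrite -rmorph_sum ltcR.
have := hA _ (fsubset_refl A); have := hA _ (fsubsetUl A B).
rewrite big_fset_disjU // !ltr_norml => /andP[+ _] /andP[_ +].
by lra.
Qed.
End Complex.
End UnorderedSums.

(** * The bilinear form on the dual lattice, integer coordinates and the discriminant group *)

Section LatticeForm.
Variable L : evenLattice.
Local Notation n := (rk L).

Lemma lformZl (K : comNzRingType) (a : K) (x y : 'rV[K]_n) :
  lform (a *: x) y = a * lform x y.
Proof. by rewrite /lform -!scalemxAl mxE. Qed.

Lemma lformDr (K : comNzRingType) (x y z : 'rV[K]_n) :
  lform x (y + z) = lform x y + lform x z.
Proof. by rewrite lformC lformDl !(lformC x). Qed.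

Lemma lformZr (K : comNzRingType) (a : K) (x y : 'rV[K]_n) :
  lform x (a *: y) = a * lform x y.
Proof. by rewrite lformC lformZl lformC. Qed.

Lemma lform_map (K K' : comNzRingType) (f : {rmorphism K -> K'}) (x y : 'rV[K]_n) :
  lform (map_mx f x) (map_mx f y) = f (lform x y).
Proof.
have eG : map_mx intr (gram L) = map_mx f (map_mx intr (gram L)).
  by apply/matrixP => i j; rewrite !mxE rmorph_int.
by rewrite /lform [in LHS]eG matrix.map_trmx -!map_mxM mxE.
Qed.

Lemma lform_toR (R : realType) (x y : dualL L) :
  lform (toR R x) (toR R y) = ratr (lform (dval x) (dval y)).
Proof. exact: lform_map. Qed.

Lemma lform_toC (R : realType) (x y : 'rV[R]_n) :
  lform (toC x) (toC y) = (lform x y)%:C.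
Proof. exact: lform_map. Qed.

Lemma toCD (R : realType) (x y : 'rV[R]_n) : toC (x + y) = toC x + toC y.
Proof. exact: map_mxD. Qed.

Lemma toRD (R : realType) (x y : dualL L) : toR R (x + y) = toR R x + toR R y.
Proof. exact: map_mxD. Qed.

Lemma bf_dclass (x y : dualL L) :
  bf (dclass x) (dclass y) = qz (lform (dval x) (dval y)).
Proof.
rewrite /bf -dclassD; change (disc_qf (dclass (x + y)) - disc_qf (dclass x) -
  disc_qf (dclass y) = qz (lform (dval x) (dval y))).
by rewrite !disc_qfE half_lformD -!qzB; congr qz; ring.
Qed.

(* The coordinates of [l] with respect to the basis of [L^*] dual to that of [L]. *)
Definition dual_coord (l : dualL L) : {ffun 'I_n -> int} :=
  [ffun j => Num.floor ((dval l *m map_mx intr (gram L)) 0 j)].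

Lemma dual_coordE (l : dualL L) j :
  (dual_coord l j)%:~R = (dval l *m map_mx intr (gram L)) 0 j.
Proof.
rewrite ffunE floorK //; have /asboolP hx := dvalP l.
have := hx (delta_mx 0 j); rewrite /lform map_delta_mx trmx_delta -colE.
by rewrite mxE.
Qed.

Lemma gram_unit : map_mx intr (gram L) \in @unitmx rat n.
Proof. by rewrite unitmxE det_map_mx unitfE intr_eq0 gram_nondeg. Qed.

Lemma dual_coord_inj : injective dual_coord.
Proof.
move=> l m /ffunP h; apply: val_inj => /=.
apply: (can_inj (mulmxK gram_unit)); apply/matrixP => i j.
by rewrite !ord1 -!dual_coordE h.
Qed.

Lemma dual_coordB (l m : dualL L) j :
  dual_coord (l - m) j = dual_coord l j - dual_coord m j.
Proof.
apply/eqP; rewrite -(eqr_int rat) rmorphB /= !dual_coordE mulmxBl.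
by rewrite mxE [X in _ + X]mxE.
Qed.

(** In dual bases the pairing has integer coefficients and no mixed terms, so [ee] of it is a
    product over the coordinates. *)
Lemma lform_dual_coord (R : realType) (l : dualL L) (z : 'rV[R[i]]_n) :
  lform (toC (toR R l)) z = \sum_j (dual_coord l j)%:~R * z 0 j.
Proof.
rewrite /lform mxE; apply: eq_bigr => j _; rewrite [z^T _ _]mxE; congr (_ * _).
have -> : toC (toR R l) *m map_mx intr (gram L) =
    map_mx (real_complex R) (map_mx ratr (dval l *m map_mx intr (gram L))).
  rewrite !map_mxM; congr (_ *m _).
  by apply/matrixP => i k; rewrite !mxE !rmorph_int.
by rewrite mxE [X in real_complex R X]mxE -dual_coordE ratr_int rmorph_int.
Qed.

(* A vector of [L^*] pairing integrally with all of [L^*] lies in [L] because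
   the rows of the inverse Gram matrix are in [L^*]. *)
Lemma discL_nondegenerate : qf_nondegenerate (discL L).
Proof.
move=> x; have [l ->] := dclass_surj x => h.
have -> : 0 = dclass (0 : dualL L) by rewrite /dclass (raddf0 \pi_(discL L))%qT.
apply/eqP; rewrite dclass_eq subr0; apply/mxOverP => i j; rewrite !ord1.
pose b : 'rV[rat]_n := delta_mx 0 j *m invmx (map_mx intr (gram L)).
have bD : b \in @in_dual L.
  apply/asboolP => m; rewrite /lform /b mulmxKV ?gram_unit //.
  by rewrite -rowE mxE !mxE intr_int.
have := h (dclass (Dual bD)); rewrite bf_dclass lformC -qz0 => /eqP.
rewrite qz_eq subr0 /= /lform /b mulmxKV ?gram_unit //.
by rewrite -rowE !mxE.
Qed.
End LatticeForm.

(** * Absolute convergence of the theta series by comparison with geometric series *)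

Section ConvergenceOfTheta.
Variables (R : realType) (L : evenLattice) (v : vsplit R L).
Local Notation n := (rk L).
Implicit Types x y : 'rV[R]_n.

Lemma projD x : proj_pos v x + proj_neg v x = x.
Proof.
by apply: daddv_pi_add; [exact/directv_addP/vsplit_direct | rewrite vsplit_full memvf].
Qed.

Lemma proj_posP x : proj_pos v x \in vpos v.
Proof. exact: memv_pi. Qed.

Lemma proj_negP x : proj_neg v x \in vneg v.
Proof. exact: memv_pi. Qed.

Lemma lform_proj x y : lform x y =
  lform (proj_pos v x) (proj_pos v y) + lform (proj_neg v x) (proj_neg v y).
Proof.
rewrite -{1}(projD x) -{1}(projD y) lformDl !lformDr.
rewrite (vsplit_orth (proj_posP x) (proj_negP y)) lformC.
rewrite [lform (proj_neg v x) (proj_pos v y)]lformC.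
by rewrite (vsplit_orth (proj_posP y) (proj_negP x)) addr0 add0r lformC.
Qed.

(** The positive definite majorant of the indefinite form attached to [v]. *)
Definition majorant x : R :=
  lform (proj_pos v x) (proj_pos v x) - lform (proj_neg v x) (proj_neg v x).

Lemma vpos_ge0 x : x \in vpos v -> 0 <= lform x x.
Proof.
move=> xv; have [->|x0] := eqVneq x 0; first by rewrite /lform !mul0mx mxE.
exact/ltW/(vpos_gt0 xv).
Qed.

Lemma vneg_le0 x : x \in vneg v -> lform x x <= 0.
Proof.
move=> xv; have [->|x0] := eqVneq x 0; first by rewrite /lform !mul0mx mxE.
exact/ltW/(vneg_lt0 xv).
Qed.

Lemma majorant_ge0 x : 0 <= majorant x.
Proof.
rewrite subr_ge0; apply: (@le_trans _ _ 0); first exact/vneg_le0/proj_negP.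
exact/vpos_ge0/proj_posP.
Qed.

(** Cauchy-Schwarz for the majorant. With opposite signs of t on the two summands, definiteness on
    [vpos] and [vneg] yields a quadratic in t whose cross term is the indefinite pairing. Bounding
    [majorant y] by [c > 0] avoids a division by zero, and t is the minimiser after this
    replacement. *)
Lemma lform_sq_le (c : R) x y : 0 < c -> majorant y <= c ->
  lform x y ^+ 2 <= c * majorant x.
Proof.
move=> c0 yc; pose t := - (lform x y / c).
have h1 : 0 <= lform (proj_pos v x + t *: proj_pos v y)
                     (proj_pos v x + t *: proj_pos v y).
  by apply: vpos_ge0; rewrite memvD ?memvZ ?proj_posP.
have h2 : lform (proj_neg v x - t *: proj_neg v y)
                (proj_neg v x - t *: proj_neg v y) <= 0.
  by apply: vneg_le0; rewrite memvB ?memvZ ?proj_negP.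
have : 0 <= majorant x + 2 * t * lform x y + t ^+ 2 * majorant y.
  move: h1 h2; rewrite -scaleNr !lformDl !lformDr !lformZl !lformZr.
  rewrite (lformC (proj_pos v y) (proj_pos v x)).
  rewrite (lformC (proj_neg v y) (proj_neg v x)) (lform_proj x y) /majorant.
  by move=> h1 h2; have := subr_ge0 0 0; lra.
have h3 : t ^+ 2 * majorant y <= t ^+ 2 * c by rewrite ler_wpM2l ?sqr_ge0.
have h4 : 2 * t * lform x y + t ^+ 2 * c = - (lform x y ^+ 2 / c).
  by rewrite /t; field; rewrite gt_eqF.
move=> h5; have : lform x y ^+ 2 / c <= majorant x by lra.
by rewrite ler_pdivrMr // mulrC.
Qed.

Lemma Im_qtau (tau : uhp R) x :
  complex.Im (qtau v tau x) = complex.Im (val tau) * majorant x / 2.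
Proof.
by rewrite /qtau /majorant; case: (val tau) => a b /=; field.
Qed.

(** The norm is exp(-pi Im(tau) majorant), and by Cauchy-Schwarz against the basis vectors the
    majorant dominates a positive multiple of the sum of the absolute coordinates. *)
Lemma norm_theta_term (tau : uhp R) : exists r : R, 0 <= r < 1 /\
  forall l : dualL L, `|ee (qtau v tau (toR R l))| <=
    (\prod_j r ^+ `|dual_coord l j|%N)%:C.
Proof.
pose e j : 'rV[R]_n := delta_mx 0 j.
(* A common bound for the majorants of the basis vectors; the summand 1 makes it positive. *)
pose c := 1 + \sum_j majorant (e j).
have c0 : 0 < c by rewrite ltr_pwDl // sumr_ge0 // => j _; exact: majorant_ge0.
have ec j : majorant (e j) <= c.
  rewrite /c (bigD1 j) //= addrCA lerDl addr_ge0 // sumr_ge0 // => k _.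
  exact: majorant_ge0.
(* Chosen so that [a] times the bound [hs] below is exactly pi Im(tau) majorant; [n.+1] in place of
   [n] keeps the denominator nonzero in rank 0. *)
pose a := pi * complex.Im (val tau) / (n.+1%:R * c).
have tau0 : 0 < complex.Im (val tau) by exact: (valP tau).
have a0 : 0 < a by rewrite !(divr_gt0, mulr_gt0, pi_gt0) // ltr0n.
exists (expR (- a)); split.
  by rewrite expR_ge0 /= expR_lt1 oppr_lt0.
move=> l; rewrite normr_ee lecR.
under eq_bigr do rewrite -expRM_natl.
rewrite -expR_sum ler_expR Im_qtau.
have coordE j : lform (toR R l) (e j) = (dual_coord l j)%:~R.
  apply: complexI; rewrite -lform_toC lform_dual_coord (bigD1 j) //=.
  rewrite big1 ?addr0 => [|k kj]; rewrite !mxE ?eqxx /= ?(negbTE kj).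
    by rewrite mulr1 rmorph_int.
  by rewrite mulr0.
(* An integer is bounded in absolute value by its square, to which Cauchy-Schwarz applies. *)
have hj j : `|dual_coord l j|%:R <= c * majorant (toR R l).
  apply: le_trans (lform_sq_le (toR R l) c0 (ec j)).
  rewrite coordE -real_normK ?num_real //.
  rewrite -intr_norm -abszE -[X in _ <= X]rmorphXn /= ler_nat.
  by case: (`|_|%N) => // m; rewrite -[X in (X <= _)%N]mulr1 leq_mul.
have hs : \sum_j `|dual_coord l j|%:R <= n.+1%:R * c * majorant (toR R l).
  apply: (@le_trans _ _ (\sum_(j < n) c * majorant (toR R l))).
    by apply: ler_sum => j _; exact: hj.
  rewrite sumr_const card_ord -[X in X <= _]mulr_natl -mulrA ler_wpM2r ?ler_nat //.
  by rewrite mulr_ge0 ?majorant_ge0 // ltW.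
have -> : \sum_j `|dual_coord l j|%:R * - a = - (a * \sum_j `|dual_coord l j|%:R).
  by rewrite -mulr_suml mulrN mulrC.
rewrite lerN2; apply: le_trans (ler_wpM2l (ltW a0) hs) _.
rewrite le_eqVlt; apply/orP; left; apply/eqP; rewrite /a; field.
by rewrite gt_eqF //= pnatr_eq0.
Qed.

Lemma sum_geometric_le (r : R) N : 0 <= r < 1 -> \sum_(k < N) r ^+ k <= (1 - r)^-1.
Proof.
case/andP=> r0 r1; have r1' : 0 < 1 - r by rewrite subr_gt0.
rewrite -[leRHS]mulr1 -ler_pdivrMl ?invr_gt0 // invrK.
have := subrX1 r N; have := exprn_ge0 N r0.
set S := \sum_(k < N) _ => h1 h2.
have -> : (1 - r) * S = 1 - r ^+ N by rewrite -opprB mulNr -h2 opprB.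
by rewrite lerBlDl lerDr.
Qed.

(** Enlarging [B] to a box turns the sum of products into a product of one-dimensional sums, each at
    most two geometric series, one per sign. *)
Lemma sum_box_le (m : nat) (r : R) (B : {fset {ffun 'I_m -> int}}) : 0 <= r < 1 ->
  \sum_(x <- B) \prod_j r ^+ `|x j|%N <= (2 / (1 - r)) ^+ m.
Proof.
move=> rI; have /andP[r0 r1] := rI.
pose N := (\max_(x <- B) \max_j `|x j|)%N.
(* [Negz k] is -(k+1), so 0 is coded only once; the same offset explains the predecessor in the
   witness below. *)
pose d (p : bool * 'I_N.+1) : int := if p.1 then Posz p.2 else Negz p.2.
pose dec (c : {ffun 'I_m -> bool * 'I_N.+1}) : {ffun 'I_m -> int} := [ffun j => d (c j)].
have d_inj : injective d.
  by move=> [[] p] [[] q] //= [] /val_inj ->.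
have dec_inj : injective dec.
  by move=> c1 c2 /ffunP h; apply/ffunP => j; apply: d_inj; have := h j; rewrite !ffunE.
pose C := [fset dec c | c in {ffun 'I_m -> bool * 'I_N.+1}]%fset.
have BC : (B `<=` C)%fset.
  apply/fsubsetP => x xB; apply/imfsetP.
  have xN j : (`|x j| < N.+1)%N.
    rewrite ltnS /N; apply: leq_trans (leq_bigmax_seq _ xB _) => //.
    exact: (leq_bigmax (F := fun j => `|x j|%N)).
  exists [ffun j => if x j is Posz k then (true, inord k)
                    else (false, inord `|x j|.-1)] => //.
  apply/ffunP => j; rewrite !ffunE; have := xN j.
  case: (x j) => k /= hk; rewrite /d /= inordK //.
  exact: ltnW.
apply: (@le_trans _ _ (\sum_(x <- C) \prod_j r ^+ `|x j|%N)).
  by apply: ler_fset_sum => // x; apply: prodr_ge0 => j _; rewrite exprn_ge0.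
rewrite big_imfset /=; last exact: in2W dec_inj.
rewrite big_enum /=.
under eq_bigr => c _ do under eq_bigr do rewrite ffunE.
rewrite -(bigA_distr_bigA (fun (_ : 'I_m) p => r ^+ `|d p|%N)) /=.
rewrite prodr_const card_ord; apply: lerXn2r; rewrite ?nnegrE.
- by apply: sumr_ge0 => p _; rewrite exprn_ge0.
- by rewrite divr_ge0 // subr_ge0 ltW.
rewrite -(pair_bigA _ (fun b k => r ^+ `|d (b, k)|%N)) /= big_bool /=.
rewrite mulr2n mulrDl mul1r lerD ?sum_geometric_le //.
apply: le_trans (sum_geometric_le N.+1 rI); apply: ler_sum => k _.
by rewrite exprS ler_piMl ?exprn_ge0 // ltW.
Qed.

(** Indexing through an injection [h] gives one constant for all fibres of [dclass]. *)
Lemma theta_terms_bounded (tau : uhp R) : exists M : R,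
  forall (I : choiceType) (h : I -> dualL L), injective h -> forall B : {fset I},
  \sum_(i <- B) `|ee (qtau v tau (toR R (h i)))| <= M%:C.
Proof.
have [r [rI hr]] := norm_theta_term tau.
exists ((2 / (1 - r)) ^+ n) => I h h_inj B.
apply: (@le_trans _ _ (\sum_(i <- B) (\prod_j r ^+ `|dual_coord (h i) j|%N)%:C)).
  by apply: ler_sum => i _; exact: hr.
rewrite -rmorph_sum lecR.
have g_inj : injective (fun i => dual_coord (h i)).
  by move=> i j /dual_coord_inj /h_inj.
have := sum_box_le [fset dual_coord (h i) | i in B]%fset rI.
by rewrite big_imfset //=; exact: in2W g_inj.
Qed.
End ConvergenceOfTheta.

(** * Translation laws and linear independence of the theta components *)

Section ThetaFunction.
Variables (R : realType) (L : evenLattice) (v : vsplit R L) (tau : uhp R).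
Local Notation n := (rk L).
Implicit Types (x y : 'rV[R]_n) (l m : dualL L) (g : discL L).

Lemma normr_ee_real (r : R) : `|ee r%:C| = 1.
Proof. by rewrite normr_ee /= mulr0 oppr0 expR0. Qed.

Lemma normr_ee_addr (z : R[i]) (r : R) : `|ee (z + r%:C)| = `|ee z|.
Proof. by rewrite eeD normrM (normr_ee_real r) mulr1. Qed.

Lemma Theta_sum zeta g s :
  hasum (fun l : {l : dualL L | dclass l == g} =>
    ee (qtau v tau (toR R (val l)) + lform (toC (toR R (val l))) zeta)) s ->
  Theta v tau zeta g = s.
Proof. by move=> h; rewrite /Theta ffunE; exact: (hasum_sum h). Qed.

Lemma Theta_hasum x g :
  hasum (fun l : {l : dualL L | dclass l == g} =>
    ee (qtau v tau (toR R (val l)) + lform (toC (toR R (val l))) (toC x)))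
  (Theta v tau (toC x) g).
Proof.
have [M hM] := theta_terms_bounded v tau.
set f := fun l : {l : dualL L | _} => _.
have [B|s hs] := @normal_hasum R _ f M.
  rewrite (eq_bigr (fun i : {l : dualL L | dclass l == g} => `|ee (qtau v tau (toR R (val i)))|)).
    by apply: hM; exact: val_inj.
  by move=> l _; rewrite /f lform_toC normr_ee_addr.
by rewrite (Theta_sum hs).
Qed.

Lemma ee_lform l m : ee (lform (toC (toR R l)) (toC (toR R m))) =
  eeQZ R (bf (dclass l) (dclass m)).
Proof. by rewrite lform_toC lform_toR bf_dclass eeQZ_qz. Qed.

(** Modulo Z, all vectors of the coset [g] have the same pairing with [m]. *)
Lemma Theta_translate_dual x m g : Theta v tau (toC x + toC (toR R m)) g =
  eeQZ R (bf (dclass m) g) * Theta v tau (toC x) g.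
Proof.
rewrite -toCD; apply: Theta_sum.
have := hasumZ (eeQZ R (bf (dclass m) g)) (Theta_hasum x g).
congr hasum; apply/funext => l; case: l => l /= /eqP <-.
by rewrite toCD lformDr addrA [RHS]eeD ee_lform bfC mulrC.
Qed.

Lemma proj_posD x y : proj_pos v (x + y) = proj_pos v x + proj_pos v y.
Proof. exact: raddfD. Qed.

Lemma proj_negD x y : proj_neg v (x + y) = proj_neg v x + proj_neg v y.
Proof. exact: raddfD. Qed.

Lemma proj_pos_id x : x \in vpos v -> proj_pos v x = x /\ proj_neg v x = 0.
Proof.
move=> xv; have xE : proj_pos v x = x.
  by apply: daddv_pi_id => //; exact/directv_addP/vsplit_direct.
split=> //; have := projD v x; rewrite xE => /(canRL (addKr _)).
by rewrite addNr.
Qed.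

Lemma lform_proj_pos x y : lform x (proj_pos v y) = lform (proj_pos v x) (proj_pos v y).
Proof.
have [e1 e2] := proj_pos_id (proj_posP v y).
rewrite (lform_proj v x) e1 e2 [X in _ + X]lformC.
by rewrite [X in _ + X]/lform !mul0mx mxE addr0.
Qed.

Lemma lform_proj_neg x y : lform x (proj_neg v y) = lform (proj_neg v x) (proj_neg v y).
Proof.
have := lform_proj v x y; rewrite -{1}(projD v y) lformDr lform_proj_pos.
exact: addrI.
Qed.

(** The cross term is the pairing of x with tau y_+ + conj(tau) y_-, which is the shift of zeta in
    the transformation law. *)
Lemma qtauD x y : qtau v tau (x + y) = qtau v tau x + qtau v tau y +
  (val tau * (lform x (proj_pos v y))%:C + conjc (val tau) * (lform x (proj_neg v y))%:C).
Proof.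
rewrite /qtau proj_posD proj_negD lform_proj_pos lform_proj_neg.
have half z t : lform (z + t) (z + t) / 2 = lform z z / 2 + lform t t / 2 + lform z t :> R.
  rewrite !lformDl !lformDr (lformC t z); by field.
rewrite !half !rmorphD /=; ring.
Qed.

(** Completing the square absorbs the shift of zeta into the summation index, which moves from l to
    l + m. *)
Lemma Theta_translate x m g :
  Theta v tau (toC x + val tau *: toC (proj_pos v (toR R m))
                     + conjc (val tau) *: toC (proj_neg v (toR R m))) g =
  ee (- qtau v tau (toR R m) - lform (toC (toR R m)) (toC x)) *
    Theta v tau (toC x) (g + dclass m).
Proof.
set c := ee _; apply: Theta_sum.
pose J g := {l : dualL L | dclass l == g}.
have hP (l : J g) : dclass (val l + m) == g + dclass m.
  by rewrite dclassD (eqP (valP l)).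
have h'P (l : J (g + dclass m)) : dclass (val l - m) == g.
  by rewrite -(inj_eq (addIr (dclass m))) -dclassD subrK (valP l).
pose h (l : J g) : J (g + dclass m) := exist _ (val l + m) (hP l).
pose h' (l : J (g + dclass m)) : J g := exist _ (val l - m) (h'P l).
have hK : cancel h h' by move=> l; apply: val_inj; rewrite /= addrK.
have h'K : cancel h' h by move=> l; apply: val_inj; rewrite /= subrK.
have := hasum_reindex hK h'K (hasumZ c (Theta_hasum x (g + dclass m))).
congr hasum; apply/funext => l; rewrite /= /c -eeD toRD qtauD toCD lformDl.
by rewrite !lformDr !lformZr !lform_toC; congr ee; change (sval tau) with (val tau); ring.
Qed.

(** N L^* lies in L: the inverse Gram matrix is the adjugate divided by the determinant, and this
    denominator divides N. *)
Lemma dvd_dual_coord_lattice (N : nat) l : (0 < N)%N ->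
  (`|\det (gram L)| %| N)%N -> (forall j, (N%:Z %| dual_coord l j)%Z) ->
  dval l \is a mxOver Num.int.
Proof.
move=> N0 dN hl.
have det0 : (\det (gram L))%:~R != 0 :> rat by rewrite intr_eq0 gram_nondeg.
have lE : dval l = (\det (gram L))%:~R^-1 *:
    (dval l *m map_mx intr (gram L) *m map_mx intr (\adj (gram L))).
  rewrite -mulmxA -map_mxM mul_mx_adj map_scalar_mx mul_mx_scalar scalerA.
  by rewrite mulVf // scale1r.
have /dvdzP[q hq] : (\det (gram L) %| N%:Z)%Z by rewrite dvdzE absz_nat.
apply/mxOverP => i j; rewrite ord1 lE mxE mxE mulr_sumr.
apply: rpred_sum => k _; rewrite -dual_coordE [map_mx _ _ _ _]mxE mulrA.
have /dvdzP[p ->] := hl k; rewrite hq mulrA intrM [_ * (\det _)%:~R]mulrC mulKf //.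
by rewrite rpredM ?intr_int.
Qed.

(** Representatives of (1/N)L modulo L. *)
Definition torsion_point (N : nat) (w : {ffun 'I_n -> 'I_N}) : 'rV[R]_n :=
  \row_j ((w j)%:R / N%:R).

(** The sum factors into one sum of roots of unity for each coordinate. *)
Lemma sum_torsion_points (N : nat) l : (0 < N)%N ->
  \sum_(w : {ffun 'I_n -> 'I_N})
    ee (lform (toC (toR R l)) (toC (torsion_point w))) =
  if [forall j, (N%:Z %| dual_coord l j)%Z] then N%:R ^+ n else 0.
Proof.
move=> N0; pose E j (k : 'I_N) := ee (((dual_coord l j)%:~R * k%:R / N%:R : R)%:C).
rewrite (eq_bigr (fun w : {ffun 'I_n -> 'I_N} => \prod_j E j (w j))); last first.
  move=> w _; rewrite lform_dual_coord ee_sum; apply: eq_bigr => j _.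
  by rewrite !mxE /E -mulrA [in RHS]rmorphM /= rmorph_int.
rewrite -(bigA_distr_bigA E) /= (eq_bigr _ (fun j _ => sum_unity_root R _ N0)).
case: ifPn => [/forallP hl|]; first by rewrite (eq_bigr (fun=> N%:R)) ?prodr_const
  ?card_ord // => j _; rewrite hl.
by rewrite negb_forall => /existsP[j /negbTE hj]; rewrite (bigD1 j) //= hj mul0r.
Qed.

(* Averaging [ee (- (l0, x)) * Theta x g] over the [N]-torsion points [x] keeps only the
   terms with [l - l0] in [N L^*]. *)
Lemma Theta_average (N : nat) (l0 : dualL L) g : (0 < N)%N ->
  hasum (fun l : {l : dualL L | dclass l == g} =>
     if [forall j, (N%:Z %| dual_coord (val l - l0) j)%Z]
     then ee (qtau v tau (toR R (val l))) else 0)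
   (\sum_(w : {ffun 'I_n -> 'I_N})
     N%:R ^- n * ee (- lform (toC (toR R l0)) (toC (torsion_point w))) *
     Theta v tau (toC (torsion_point w)) g).
Proof.
move=> N0; pose x (w : {ffun 'I_n -> 'I_N}) := toC (torsion_point w).
have := hasum_lincomb (fun w => N%:R ^- n * ee (- lform (toC (toR R l0)) (x w)))
  (fun w : {ffun 'I_n -> 'I_N} => Theta_hasum (torsion_point w) g).
congr hasum; apply/funext => l /=.
have NR : N%:R != 0 :> R[i] by rewrite pnatr_eq0 -lt0n.
rewrite (eq_bigr (fun w => N%:R ^- n * ee (qtau v tau (toR R (val l))) *
  ee (lform (toC (toR R (val l - l0))) (x w)))); last first.
  move=> w _; rewrite -[LHS]mulrA -[RHS]mulrA -!eeD; congr (_ * ee _).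
  have -> : lform (toC (toR R (val l))) (x w) =
      lform (toC (toR R (val l - l0))) (x w) + lform (toC (toR R l0)) (x w).
    by rewrite -lformDl -toCD -toRD subrK.
  by rewrite /x; ring.
rewrite -mulr_sumr sum_torsion_points //; case: ifP => _; last by rewrite mulr0.
by rewrite mulrAC mulVf ?mul1r // expf_neq0.
Qed.

Lemma fset_bounded (I : choiceType) (A : {fset I}) (f : I -> nat) :
  exists K, forall i, i \in A -> (f i <= K)%N.
Proof. by exists (\max_(i <- A) f i)%N => i iA; exact: leq_bigmax_seq. Qed.

Lemma Theta_independent (c : discL L -> R[i]) :
  (forall x, \sum_g c g * Theta v tau (toC x) g = 0) -> forall g, c g = 0.
Proof.
move=> hc g0; have [l0 g0E] := dclass_surj g0.
pose J := {l : dualL L | dclass l == g0}.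
have j0P : dclass l0 == g0 by rewrite g0E.
pose j0 : J := exist _ l0 j0P.
have [M hM] := theta_terms_bounded v tau.
pose a l := ee (qtau v tau (toR R l)).
(* The norm of the term of [l0]; outside [A] the norms will add up to less than half of it. *)
pose e := expR (- (2%:R * pi * complex.Im (qtau v tau (toR R l0)))).
have e0 : 0 < e by exact: expR_gt0.
have e2 : 0 < e / 2 by rewrite divr_gt0.
have [A hA] := normal_tail (fun B => hM J val val_inj B) e2.
have [K coordK] := fset_bounded A (fun l : J => \max_(j < n) `|dual_coord (val l - l0)%R j|)%N.
(* The determinant keeps the surviving terms in the class of [l0]; the factor [K.+1] makes [N]
   exceed every coordinate of [l - l0] in absolute value for [l] in [A]. *)
pose N := (`|\det (gram L)| * K.+1)%N.
have d0 : (0 < `|\det (gram L)|)%N by rewrite absz_gt0 gram_nondeg.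
have N0 : (0 < N)%N by rewrite muln_gt0 d0.
have KN : (K < N)%N by rewrite /N; apply: leq_pmull.
pose T g := \sum_(w : {ffun 'I_n -> 'I_N})
     N%:R ^- n * ee (- lform (toC (toR R l0)) (toC (torsion_point w))) *
     Theta v tau (toC (torsion_point w)) g.
have hT g := Theta_average l0 g N0 : hasum _ (T g).
have T0 g : g != g0 -> T g = 0.
  move=> gg0; apply: hasum_uniq (hT g) _.
  have := @hasum0 R[i] {l : dualL L | dclass l == g}.
  congr hasum; apply/funext => l; case: ifP => // /forallP hl.
  have := dvd_dual_coord_lattice N0 (dvdn_mulr _ (dvdnn _)) hl.
  rewrite -dclass_eq => /eqP le; case/negP: gg0.
  by rewrite -(eqP (valP l)) le g0E.
have sumT : \sum_g c g * T g = 0.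
  under eq_bigr do rewrite mulr_sumr.
  rewrite exchange_big /= big1 // => w _.
  under eq_bigr do rewrite mulrCA.
  by rewrite -mulr_sumr hc mulr0.
move: sumT; rewrite (bigD1 g0) //= big1 ?addr0 => [|g gg0]; last by rewrite T0 ?mulr0.
move/eqP; rewrite mulf_eq0 => /orP[/eqP //|/eqP Tg0].
(* As [T g0] vanishes, this would bound [e], the norm of [a l0], by e/2. *)
suff : `|T g0 - a l0| <= (e / 2)%:C.
  by rewrite Tg0 sub0r normrN /a normr_ee lecR -/e leNgt gtr_pMr ?invf_lt1 ?ltr1n.
apply: (hasum_dist_le (A := (j0 |` A)%fset) (hT g0)) => B AB.
have j0B : j0 \in B by rewrite (fsubsetP AB) // !inE eqxx.
rewrite (big_fsetD1 j0) //= ifT; last first.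
  by apply/forallP => j; rewrite dual_coordB subrr dvdz0.
rewrite -/(a l0) addrAC subrr add0r; apply: le_trans (ler_norm_sum _ _ _) _.
(* Terms in [A] other than that of [l0] drop out: a multiple of [N] of absolute value at most
   [K < N] is 0, so all coordinates of [l - l0] would vanish. *)
pose b (l : J) := if l \in A then 0 else `|a (val l)|.
apply: (@le_trans _ _ (\sum_(l <- (B `\ j0)%fset) b l)).
  rewrite big_seq [leRHS]big_seq; apply: ler_sum => l; rewrite !inE => /andP[lj0 _].
  rewrite /b; case: (boolP (l \in A)) => [lA|_]; last by case: ifP; rewrite ?normr0.
  case: ifP => [/forallP hl|]; last by rewrite normr0.
  case/negP: lj0; apply/eqP/val_inj/dual_coord_inj/ffunP => j /=.
  apply/eqP; rewrite -subr_eq0 -dual_coordB -absz_eq0.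
  have := hl j; rewrite dvdzE absz_nat; apply: contraLR; rewrite -lt0n => c0.
  rewrite gtnNdvd //; apply: leq_ltn_trans KN.
  apply: leq_trans (coordK l lA).
  exact: (@leq_bigmax _ (fun j => absz (dual_coord (val l - l0) j)) j).
have b0 (l : J) : 0 <= b l by rewrite /b; case: ifP.
apply: le_trans (ler_fset_sum b0 (fsubD1set _ _)) _.
rewrite (big_fsetID _ (mem A)) /= big1_fset ?add0r => [|l]; last first.
  by rewrite !inE /b /= => /andP[_ ->].
apply: le_trans (ltW (hA [fset l : J in B | l \notin A]%fset _)).
  by apply: ler_sum => l _; rewrite /b; case: ifP.
by apply/fdisjointP => l lA; rewrite !inE lA andbF.
Qed.
End ThetaFunction.

(** * Coefficient formulas for the operators on group algebras *)

Section GroupAlgebraOperators.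
Variable R : realType.

Lemma linextE (A B : finType) (phi : A -> grpalg R B) (f : grpalg R A) b :
  linext phi f b = \sum_a f a * phi a b.
Proof. by rewrite /linext sum_ffunE; apply: eq_bigr => a _; rewrite ffunE. Qed.

Lemma sum_mul_delta (A : finType) (f : A -> R[i]) a : \sum_c f c * (c == a)%:R = f a.
Proof.
rewrite (bigD1 a) //= eqxx mulr1 big1 ?addr0 // => c /negbTE ->.
by rewrite mulr0.
Qed.

Lemma sum_at_most_one (I : finType) (P : pred I) (c : R[i]) :
  (forall i j, P i -> P j -> i = j) ->
  \sum_(i | P i) c = if [exists i, P i] then c else 0.
Proof.
move=> Puniq; case: ifPn => [/existsP[i Pi]|/existsPn nP]; last first.
  by apply: big1 => i /(elimN idP (nP i)).
rewrite (bigD1 i) //= big1 ?addr0 // => j /andP[Pj /eqP ji].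
by case: ji; exact: Puniq.
Qed.

Section OneForm.
Variables (E : finQuadType) (Y : isoSubgroup E).

(** A predicate on all of [E], false off Y^perp, so that sums over a class need no subtype. *)
Definition in_class (b : subquot Y) (p : E) : bool :=
  [exists x : perpT Y, (pval x == p) && (subclass x == b)].

Lemma in_classP b p :
  reflect (exists2 x : perpT Y, pval x = p & subclass x = b) (in_class b p).
Proof.
by apply: (iffP existsP) => [[x /andP[/eqP h1 /eqP h2]]|[x <- <-]]; exists x; rewrite ?eqxx.
Qed.

Lemma in_class_pval b (x : perpT Y) : in_class b (pval x) = (subclass x == b).
Proof.
apply/in_classP/eqP => [[y /val_inj ->] //|<-]; by exists x.
Qed.

Lemma downarrowE (f : grpalg R E) b :
  downarrow Y f b = \sum_(p | in_class b p) f p.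
Proof.
rewrite linextE [RHS]big_mkcond; apply: eq_bigr => p _.
case: insubP => [x _ xp|np].
  rewrite ffunE -xp /= in_class_pval eq_sym.
  by case: eqP; rewrite ?mulr1 ?mulr0.
rewrite ffunE mulr0; case: in_classP => // -[x xp _].
by case/negP: np; rewrite -xp pvalP.
Qed.

(** With [uparrow_notin] this describes the image of [uparrow]: functions supported on Y^perp and
    constant on cosets of Y. *)
Lemma uparrow_pval (f : grpalg R (subquot Y)) (x : perpT Y) :
  uparrow f (pval x) = f (subclass x).
Proof.
rewrite linextE -[RHS]sum_mul_delta; apply: eq_bigr => b _; congr (_ * _).
rewrite sum_ffunE -[RHS](sum_mul_delta (fun y => (b == subclass y)%:R)) [LHS]big_mkcond.
apply: eq_bigr => y _; rewrite ffunE (inj_eq val_inj) [x == y]eq_sym.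
by rewrite [b == _]eq_sym; case: ifP => _; rewrite ?mul1r ?mul0r.
Qed.

Lemma uparrow_notin (f : grpalg R (subquot Y)) (p : E) :
  p \notin perp Y -> uparrow f p = 0.
Proof.
move=> np; rewrite linextE big1 // => b _; rewrite sum_ffunE big1 ?mulr0 // => y _.
by rewrite ffunE; case: eqP => // py; case/negP: np; rewrite py pvalP.
Qed.

Lemma bf_subclass (x y : perpT Y) :
  bf (subclass x) (subclass y) = bf (pval x) (pval y).
Proof.
rewrite /bf -subclassD; change (subquot_qf (subclass (x + y)) - subquot_qf (subclass x)
  - subquot_qf (subclass y) = bf (pval x) (pval y)).
by rewrite !subquot_qfE.
Qed.
End OneForm.

Lemma bf_prod (A B : finQuadType) (x y : A * B) :
  bf x y = bf x.1 y.1 + bf x.2 y.2.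
Proof.
change (prod_qf (x + y) - prod_qf x - prod_qf y = bf x.1 y.1 + bf x.2 y.2).
have -> : prod_qf (x + y) = prod_qf x + prod_qf y + (bf x.1 y.1 + bf x.2 y.2).
  by rewrite /prod_qf /= !qfD addrACA; congr (_ + _); exact: addrACA.
by rewrite -addrA -opprD addrC addKr.
Qed.

Section Twists.
Variables (L : evenLattice) (D : finQuadType) (H : isoSubgroup (discL L * D)%type).
Variable S : KLsection H.

Lemma tshiftE (m : dualL L) (f : grpalg R (subquot H)) b :
  tshift S m f b = f (b + subclass (sec S (dclass m))).
Proof.
rewrite linextE -[RHS]sum_mul_delta; apply: eq_bigr => c _.
by rewrite ffunE eq_sym subr_eq.
Qed.

Lemma chiopE (m : dualL L) (f : grpalg R (subquot H)) b :
  chiop S m f b = eeQZ R (bf (subclass (sec S (dclass m))) b) * f b.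
Proof.
rewrite linextE.
rewrite -[RHS](sum_mul_delta (fun c => eeQZ R (bf (subclass (sec S (dclass m))) c) * f c)).
by apply: eq_bigr => c _; rewrite ffunE [ebase _ _ _]ffunE eq_sym mulrCA mulrA.
Qed.

Lemma PmapE (f : grpalg R (subquot (Hprime S))) b :
  Pmap f b = \sum_(a | prel b a) f a.
Proof.
rewrite linextE [RHS]big_mkcond; apply: eq_bigr => a _; rewrite sum_ffunE.
case: ifPn => ba.
  rewrite (bigD1 b) //= ffunE eqxx big1 ?addr0 ?mulr1 // => c /andP[_ cb].
  by rewrite ffunE eq_sym (negbTE cb).
rewrite big1 ?mulr0 // => c ca; rewrite ffunE.
by case: eqP => // bc; move: ba; rewrite bc ca.
Qed.
End Twists.

(** Grouping by the first component exposes the coefficients to which [Theta_independent]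
    applies. *)
Lemma PhiE (L : evenLattice) (v : vsplit R L) (D : finQuadType)
    (H : isoSubgroup (discL L * D)%type) (F : uhp R -> grpalg R D) tau zeta b :
  Phi v H F tau zeta b =
  \sum_g (\sum_(d | in_class b (g, d)) F tau d) * Theta v tau zeta g.
Proof.
rewrite /Phi downarrowE (eq_bigr (fun p => Theta v tau zeta p.1 * F tau p.2)); last first.
  by move=> p _; rewrite ffunE.
under [RHS]eq_bigr do rewrite mulrC mulr_sumr.
rewrite pair_big_dep /=; apply: eq_big => [[g d]|[g d] _] //.
Qed.
End GroupAlgebraOperators.

(** * Consequences of horizontality for classes in H^perp / H *)

Section HorizontalSubgroup.
Variables (R : realType) (L : evenLattice) (D : finQuadType).
Variables (H : isoSubgroup (discL L * D)%type) (H_hor : horizontal H).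

(* Evaluate [\sum_x \sum_(h in H) e((x, h_L) + (d, h_D))] in both orders: summing over [x]
   first leaves only [h = 0], summing over [h] first leaves only the [x] with [(x, d)]
   orthogonal to [H]. *)
Lemma perp_proj_surj (d : D) : exists x : perpT H, (pval x).2 = d.
Proof.
pose chi (p h : discL L * D) := eeQZ R (bf p h).
have chiD p : {in H &, forall h h', chi p (h + h') = chi p h * chi p h'}.
  by move=> h h' _ _; rewrite /chi bfC bfDl eeQZD !(bfC p).
have chi_sum x : (x, d) \notin perp H -> \sum_(h in (H : {set _})) chi (x, d) h = 0.
  move=> nx; apply: (sum_character (iso_zmod H) (chiD (x, d))).
  move: nx; rewrite unfold_in negb_forall_in => /exists_inP[h hH bh].
  by exists h => //; apply: contraNneq bh => /eeQZ_eq1 ->.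
apply: contrapT => noX.
have nx x : (x, d) \notin perp H.
  by apply/negP => xd; apply: noX; exists (PerpT xd).
have : \sum_x \sum_(h in (H : {set _})) chi (x, d) h = 0.
  by apply: big1 => x _; exact: chi_sum.
rewrite exchange_big /= (bigD1 0) /=; last by have [] := iso_zmod H.
rewrite [X in _ + X]big1 ?addr0 => [|h /andP[hH h0]].
  rewrite (eq_bigr (fun=> 1)); last by move=> x _; rewrite /chi bfC bf0l eeQZ0.
  rewrite sumr_const => /eqP; rewrite pnatr_eq0 => /eqP c0.
  by have := max_card (pred1 (0 : discL L)); rewrite card1 c0.
have h1 : h.1 != 0.
  apply: contraNneq h0; case: h hH => a b /= hH a0; rewrite a0 in hH *.
  by rewrite (H_hor.2 b hH).
have chiE x : chi (x, d) h = eeQZ R (bf d h.2) * eeQZ R (bf h.1 x).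
  by rewrite /chi bf_prod /= eeQZD mulrC [bf x _]bfC.
rewrite (eq_bigr _ (fun x _ => chiE x)) -mulr_sumr.
rewrite (_ : \sum_x _ = \sum_(x in [set: discL L]) eeQZ R (bf h.1 x)); last first.
  by apply: eq_bigl => x; rewrite !inE.
rewrite sum_character ?mulr0 //.
- by split=> [|x y _ _]; rewrite inE.
- by move=> x y _ _; rewrite bfC bfDl eeQZD !(bfC h.1).
- apply: contrapT => ny; case/eqP: h1; apply: discL_nondegenerate => y.
  apply: contrapT => hy; apply: ny; exists y; rewrite ?inE //.
  by apply/eqP => /eeQZ_eq1.
Qed.

(** The difference is an element (0, y) of H, hence zero. *)
Lemma horizontal_inj (p q : discL L * D) :
  p - q \in (H : {set _}) -> p.1 = q.1 -> p = q.
Proof.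
case: p q => [a b] [c d] h /= e; move: h; rewrite e => h.
have /eqP : b - d = 0.
  apply: H_hor.2; have <- : (c, b) - (c, d) = (0, b - d) by congr (_, _); rewrite /= subrr.
  by [].
by rewrite subr_eq0 => /eqP ->.
Qed.

Lemma in_class_inj (b : subquot H) g d d' :
  in_class b (g, d) -> in_class b (g, d') -> d = d'.
Proof.
case/in_classP => x xp <- /in_classP[y yp /eqP].
rewrite subclass_eq xp yp => /horizontal_inj -/(_ erefl) [] //.
Qed.

Lemma sum_in_class (x : perpT H) (f : D -> R[i]) :
  \sum_(d | in_class (subclass x) ((pval x).1, d)) f d = f (pval x).2.
Proof.
have xx : in_class (subclass x) ((pval x).1, (pval x).2).
  by rewrite -surjective_pairing in_class_pval.
rewrite (bigD1 (pval x).2) //= big1 ?addr0 // => d /andP[xd /eqP].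
by case; exact: in_class_inj xd xx.
Qed.
End HorizontalSubgroup.

(** * Support and invariance of F from the transformation law *)

Section Transformation.
Variables (R : realType) (L : evenLattice) (v : vsplit R L) (D : finQuadType).
Variables (H : isoSubgroup (discL L * D)%type) (H_hor : horizontal H).
Variables (S : KLsection H) (F : uhp R -> grpalg R D).
Hypothesis F_trans : forall (tau : uhp R) (zeta : 'rV[R[i]]_(rk L)) (sigma nu : dualL L),
    dclass sigma \in KL S -> dclass nu \in KL S ->
    Phi v H F tau
      (zeta + val tau *: toC (proj_pos v (toR R sigma))
            + conjc (val tau) *: toC (proj_neg v (toR R sigma))
            + toC (toR R nu)) =
    gscale (ee (- qtau v tau (toR R sigma) - lform (toC (toR R sigma)) zeta))
      (chiop S nu (tshift S sigma (Phi v H F tau zeta))).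

Lemma toR0 : toR R (0 : dualL L) = 0.
Proof. exact: map_mx0. Qed.

Lemma toC0 : toC (0 : 'rV[R]_(rk L)) = 0.
Proof. exact: map_mx0. Qed.

Lemma qtau0 tau : qtau v tau 0 = 0.
Proof.
rewrite /qtau /proj_pos /proj_neg !linear0 /lform !mul0mx !mxE mul0r.
by rewrite !mulr0 addr0.
Qed.

Lemma dclass0 : dclass (0 : dualL L) = 0.
Proof. exact: (raddf0 \pi_(discL L))%qT. Qed.

Lemma KL0 : 0 \in KL S.
Proof. by have [] := KL_zmod S. Qed.

Lemma sec0 : subclass (sec S 0) = 0.
Proof.
have -> : sec S 0 = 0 by apply: (addrI (sec S 0)); rewrite -secD ?KL0 // !addr0.
exact: (raddf0 \pi_(subquot H))%qT.
Qed.

Lemma Phi_translate_dual tau x nu b : dclass nu \in KL S ->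
  Phi v H F tau (toC x + toC (toR R nu)) b =
  eeQZ R (bf (subclass (sec S (dclass nu))) b) * Phi v H F tau (toC x) b.
Proof.
move=> nuK; have := F_trans tau (toC x) (sigma := 0); rewrite dclass0.
move=> /(_ nu KL0 nuK).
rewrite toR0 /proj_pos /proj_neg !linear0 toC0 !scaler0 !addr0 => ->.
rewrite ffunE chiopE tshiftE dclass0 sec0 addr0 qtau0.
by rewrite /lform !mul0mx mxE subr0 oppr0 ee0 mul1r.
Qed.

Lemma Phi_translate tau x sigma b : dclass sigma \in KL S ->
  Phi v H F tau
    (toC x + val tau *: toC (proj_pos v (toR R sigma))
           + conjc (val tau) *: toC (proj_neg v (toR R sigma))) b =
  ee (- qtau v tau (toR R sigma) - lform (toC (toR R sigma)) (toC x)) *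
    Phi v H F tau (toC x) (b + subclass (sec S (dclass sigma))).
Proof.
move=> sK; have := F_trans tau (toC x) (nu := 0) sK; rewrite dclass0.
move=> /(_ KL0); rewrite toR0 toC0 addr0 => ->.
by rewrite ffunE chiopE tshiftE dclass0 sec0 bf0l eeQZ0 mul1r.
Qed.

(** Translation by nu multiplies Theta_g by e((nu, g)) and Phi_beta by e((s(nu), beta)). For x in
    beta with x_D = d these factors at g = x_L differ by e((s(nu)_D, d)), which is not 1 for a
    suitable nu, so the coefficient F_d must vanish. *)
Lemma F_supported tau (d : D) : d \notin perp (Isub S) -> F tau d = 0.
Proof.
rewrite unfold_in negb_forall_in => /exists_inP[_ /imsetP[k kK ->] dk].
have [x xd] := perp_proj_surj R H_hor d; have [nu kE] := dclass_surj k.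
rewrite {k}kE in kK dk; pose b := subclass x.
pose c (g : discL L) := \sum_(d | in_class b (g, d)) F tau d.
have PhiC z : Phi v H F tau z b = \sum_g c g * Theta v tau z g by exact: PhiE.
pose a := eeQZ R (bf (subclass (sec S (dclass nu))) b).
have indep : (eeQZ R (bf (dclass nu) (pval x).1) - a) * c (pval x).1 = 0.
  apply: (@Theta_independent _ _ v tau
    (fun g => (eeQZ R (bf (dclass nu) g) - a) * c g)) => y.
  have := etrans (eq_bigr _ (fun g _ => congr1 ( *%R (c g))
      (esym (Theta_translate_dual v tau y nu g))))
    (etrans (esym (PhiC (toC y + toC (toR R nu))))
      (etrans (Phi_translate_dual tau y b kK) (congr1 ( *%R a) (PhiC (toC y))))).
  move: (Theta v tau (toC y)) => T.
  rewrite mulr_sumr => /eqP; rewrite -subr_eq0 -sumrB => /eqP; apply: etrans.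
  apply: eq_bigr => g _; ring.
move/eqP: indep; rewrite mulf_eq0 /c sum_in_class // xd => /orP[|/eqP //].
rewrite subr_eq0 /a bf_subclass bf_prod sec_fst // eeQZD -subr_eq0 -{1}[eeQZ _ _]mulr1.
rewrite -mulrBr mulf_eq0 (negbTE (eeQZ_neq0 _ _)) /= subr_eq0 eq_sym => /eqP/eeQZ_eq1.
by rewrite bfC xd => h; rewrite h eqxx in dk.
Qed.

(** The shift by sigma moves Theta_g to Theta_(g + sigma) and beta to beta + s(sigma) with the same
    automorphy factor. Comparing the coefficients of Theta at x_L + sigma gives F at x_D on one side
    and at x_D + s(sigma)_D on the other. *)
Lemma F_invariant tau (d i : D) : i \in Iset S -> F tau (d + i) = F tau d.
Proof.
case/imsetP => k kK ->; have [x <-] := perp_proj_surj R H_hor d.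
have [sg kE] := dclass_surj k; rewrite {k}kE in kK *.
pose b := subclass x; pose s := sec S (dclass sg).
pose c (b' : subquot H) (g : discL L) := \sum_(d | in_class b' (g, d)) F tau d.
have PhiC b' z : Phi v H F tau z b' = \sum_g c b' g * Theta v tau z g by exact: PhiE.
have indep : c b ((pval x).1 + dclass sg - dclass sg) -
    c (b + subclass s) ((pval x).1 + dclass sg) = 0.
  apply: (@Theta_independent _ _ v tau
    (fun g => c b (g - dclass sg) - c (b + subclass s) g)) => y.
  set e := ee (- qtau v tau (toR R sg) - lform (toC (toR R sg)) (toC y)).
  have := etrans (eq_bigr _ (fun g _ => congr1 ( *%R (c b g))
      (esym (Theta_translate v tau y sg g))))
    (etrans (esym (PhiC b _)) (etrans (Phi_translate tau y b kK)
      (congr1 ( *%R e) (PhiC (b + subclass s) (toC y))))).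
  move: (Theta v tau (toC y)) => T; rewrite -/e.
  under eq_bigr do rewrite mulrCA.
  rewrite -mulr_sumr => /(mulfI (ee_neq0 _)).
  rewrite [LHS](reindex_inj (addIr (- dclass sg))) /= => /eqP.
  rewrite -subr_eq0 -sumrB => /eqP; apply: etrans.
  by apply: eq_bigr => g _; rewrite mulrBl subrK.
have e1 : c b (pval x).1 = F tau (pval x).2 by exact: sum_in_class.
have e2 : c (b + subclass s) ((pval x).1 + dclass sg) = F tau ((pval x).2 + (pval s).2).
  have -> : b + subclass s = subclass (x + s) by rewrite subclassD.
  have -> : (pval x).1 + dclass sg = (pval (x + s)).1 by rewrite /= sec_fst.
  exact: (sum_in_class H_hor (x + s)).
by have := subr0_eq indep; rewrite addrK => e3; exact: etrans (esym e2) (etrans (esym e3) e1).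
Qed.
End Transformation.

(** * Comparison of classes modulo H with classes modulo H' *)

Section Projection.
Variables (R : realType) (L : evenLattice) (D : finQuadType).
Variables (H : isoSubgroup (discL L * D)%type) (H_hor : horizontal H).
Variable S : KLsection H.

Lemma image_perp_Hprime (x : perpT H) (z : perpT (Isub S)) :
  pval z = (pval x).2 -> ((pval x).1, subclass z) \in perp (Hprime S).
Proof.
move=> zx; apply/perpP => _ /Hprime_setP[h [t [hH th ->]]].
rewrite bf_prod /= bf_subclass zx th -bf_prod.
by have /perpP := pvalP x; apply.
Qed.

(** Both sides are regrouped by e in I^perp / I. Each group has at most one index, on the left by
    horizontality and on the right because (g, e) determines its class, so only existence has to be
    compared. *)
Lemma Pmap_fibre (f : subquot (Isub S) -> R[i]) (b : subquot H) g :
  \sum_(z : perpT (Isub S) | in_class b (g, pval z)) f (subclass z) =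
  \sum_(a : subquot (Hprime S) | prel b a) \sum_(e | in_class a (g, e)) f e.
Proof.
rewrite (exchange_big_dep xpredT) //=.
rewrite (partition_big (fun z : perpT (Isub S) => subclass z) xpredT) //=.
apply: eq_bigr => e _.
rewrite (eq_bigr (fun=> f e)); last by move=> z /andP[_ /eqP ->].
rewrite !sum_at_most_one; first last.
- move=> z t /andP[bz _] /andP[bt _]; apply: val_inj.
  exact: (in_class_inj H_hor bz bt).
- move=> a a' /andP[_ /in_classP[y yp <-]] /andP[_ /in_classP[y' yp' <-]].
  by congr subclass; apply: val_inj; rewrite /= yp yp'.
congr (if _ then _ else _); apply/existsP/existsP => [[z /andP[bz /eqP ze]]|].
  case/in_classP: bz => x xp xb.
  have zx : pval z = (pval x).2 by rewrite xp.
  pose y := PerpT (image_perp_Hprime zx).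
  exists (subclass y); apply/andP; split.
    apply/existsP; exists x; apply/existsP; exists z; apply/existsP; exists y.
    by rewrite xb zx !eqxx.
  by apply/in_classP; exists y => //=; rewrite xp ze.
case=> a /andP[/existsP[x /existsP[z /existsP[y /and4P[/eqP xb /eqP zx /eqP yp /eqP ya]]]]].
(* [y'] and [y] differ by an element of H', which comes from some [h] in H; adding [h] to [x] keeps
   the class [b] and corrects the first component to [g]. *)
case/in_classP => y' yp' /eqP; rewrite -ya subclass_eq yp yp'.
case/Hprime_setP => h [t [hH th [h1 h2]]].
(* H lies in its own orthogonal complement since q vanishes on [h], [h'] and [h + h']. *)
have hP : h \in perp H.
  have [H0 HB] := iso_zmod H; apply/perpP => h' h'H; rewrite /bf.
  rewrite (@iso_qf0 _ H _ hH) (@iso_qf0 _ H _ h'H) (@iso_qf0 _ H) ?subrr //.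
  by rewrite -[h']opprK -[- h']sub0r !HB.
pose x' := x + PerpT hP.
exists (z + t); apply/andP; split.
  apply/in_classP; exists x'.
    have -> : pval x' = ((pval x).1 + h.1, (pval x).2 + h.2) by [].
    by rewrite -h1 -zx -th addrC subrK.
  by apply/eqP; rewrite -xb subclass_eq /x' /= addrAC subrr add0r.
by rewrite subclassD -h2 addrC subrK.
Qed.
End Projection.

(** * Descent of F to I^perp / I and the resulting identity for Phi *)

Theorem theorem5p15 (R : realType) (L : evenLattice) (v : vsplit R L)
  (D : finQuadType) (D_nondeg : qf_nondegenerate D)
  (H : isoSubgroup (discL L * D)%type) (H_hor : horizontal H)
  (S : KLsection H)
  (F : uhp R -> grpalg R D) (F_smooth : smooth F)
  (F_trans : forall (tau : uhp R) (zeta : 'rV[R[i]]_(rk L)) (sigma nu : dualL L),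
    dclass sigma \in KL S -> dclass nu \in KL S ->
    Phi v H F tau
      (zeta + val tau *: toC (proj_pos v (toR R sigma))
            + conjc (val tau) *: toC (proj_neg v (toR R sigma))
            + toC (toR R nu)) =
    gscale (ee (- qtau v tau (toR R sigma) - lform (toC (toR R sigma)) zeta))
      (chiop S nu (tshift S sigma (Phi v H F tau zeta)))) :
  exists G : uhp R -> grpalg R (subquot (Isub S)),
    [/\ forall tau, F tau = uparrow (G tau),
        forall G' : uhp R -> grpalg R (subquot (Isub S)),
          (forall tau, F tau = uparrow (G' tau)) -> G' = G
      & forall tau zeta,
          Phi v H F tau zeta = Pmap (Phi v (Hprime S) G tau zeta)].
Proof.
(* The chosen representative is immaterial by the invariance of F under I, which is the content of
   [GE]. *)
pose G tau : grpalg R (subquot (Isub S)) := [ffun e => F tau (pval (subrepr e))].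
have GE tau (z : perpT (Isub S)) : G tau (subclass z) = F tau (pval z).
  have /eqP := subreprK (subclass z); rewrite subclass_eq ffunE => zI.
  by rewrite -(F_invariant H_hor F_trans tau (pval z) zI) addrC subrK.
have FE tau : F tau = uparrow (G tau).
  apply/ffunP => d; have [dI|dI] := boolP (d \in perp (Isub S)).
    by rewrite -[d]/(pval (PerpT dI)) uparrow_pval GE.
  by rewrite uparrow_notin // (F_supported H_hor F_trans).
exists G; split=> // [G' FG'|tau zeta].
  apply/funext => tau; apply/ffunP => e; have [z ->] := subclass_surj e.
  by rewrite GE FG' uparrow_pval.
apply/ffunP => b; rewrite PmapE PhiE.
under [RHS]eq_bigr do rewrite PhiE.
rewrite exchange_big /=; apply: eq_bigr => g _; rewrite -mulr_suml; congr (_ * _).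
rewrite -(Pmap_fibre H_hor (G tau)).
rewrite (eq_bigr (fun z : perpT (Isub S) => F tau (pval z))); last by move=> z _; exact: GE.
(* The d outside I^perp contribute nothing; those inside are reindexed by the subtype over which
   [Pmap_fibre] sums. *)
rewrite (bigID (fun d => d \in perp (Isub S))) /= [X in _ + X]big1 ?addr0; last first.
  by move=> d /andP[_ dI]; exact: (F_supported H_hor F_trans).
rewrite (reindex_omap (@pval D (Isub S)) insub) /=; last first.
  by move=> d /andP[_ dI]; rewrite insubT.
apply: eq_bigl => z; have -> : insub (pval z) = Some z by exact: valK.
by rewrite pvalP eqxx !andbT.
Qed.
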